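(* Let $n\geq 1$ and let ${}_{\mathcal{L}}\mathbf{SBIA}_n$ be the free left-handed skew Boolean intersection algebra over an $n$-element set. Let $B_m$ denote the $m$th Bell number and $S(m,k)$ the Stirling number of the second kind. Then: (1) ${}_{\mathcal{L}}\mathbf{SBIA}_n$ has precisely $B_{n+1}-1$ atomic $\mathcal{D}$-classes. (2) $${}_{\mathcal{L}}\mathbf{SBIA}_n\simeq\mathbf{2}^{S(n+1,2)}\times\mathbf{3}_L^{S(n+1,3)}\times\dots\times(\mathbf{n+1})_L^{S(n+1,n+1)}.$$ Consequently, $$|{}_{\mathcal{L}}\mathbf{SBIA}_n|=2^{S(n+1,2)}\,3^{S(n+1,3)}\cdots(n+1)^{S(n+1,n+1)}.$$ (3) ${}_{\mathcal{L}}\mathbf{SBIA}_n$ has precisely $B_{n+2}-2B_{n+1}$ atoms. (4) There are precisely $2^{S(n+1,2)}=2^{2^n-1}$ singleton $\mathcal{D}$-classes in ${}_{\mathcal{L}}\mathbf{SBIA}_n$, so that the center of ${}_{\mathcal{L}}\mathbf{SBIA}_n$ is isomorphic to $\mathbf{2}^{2^n-1}$, which is isomorphic to $\mathbf{GBA}_n$, the free generalized Boolean algebra on $n$ generators.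
   Context: A skew Boolean algebra (SBA) is an algebra $(S;\wedge,\vee,\setminus,0)$ of type $(2,2,2,0)$ satisfying: $\wedge$ and $\vee$ are associative; $x\vee(x\wedge y)=x=(y\wedge x)\vee x$ and $x\wedge(x\vee y)=x=(y\vee x)\wedge x$; $x\wedge(y\vee z)=(x\wedge y)\vee(x\wedge z)$ and $(y\vee z)\wedge x=(y\wedge x)\vee(z\wedge x)$; $x\vee 0=0\vee x=x$ and $x\wedge 0=0\wedge x=0$; $(x\setminus y)\wedge y=y\wedge(x\setminus y)=0$ and $(x\setminus y)\vee(x\wedge y\wedge x)=x=(x\wedge y\wedge x)\vee(x\setminus y)$; $x\wedge y\wedge z\wedge t=x\wedge z\wedge y\wedge t$. It is left-handed if also $x\wedge y\wedge x=x\wedge y$ and $x\vee y\vee x=y\vee x$. The natural partial order is: $x\leq y$ iff $x\wedge y=y\wedge x=x$. An SBA has intersections if any two elements $x,y$ have a greatest lower bound $x\sqcap y$ with respect to $\leq$; a (left-handed) skew Boolean intersection algebra (SBIA) is an algebra $(S;\wedge,\vee,\setminus,\sqcap,0)$ where $(S;\wedge,\vee,\setminus,0)$ is a (left-handed) SBA with intersections and $\sqcap$ is this meet operation. Left-handed SBIAs form a variety in the signature $(\wedge,\vee,\setminus,\sqcap,0)$; free algebras are free algebras in this variety. Generalized Boolean algebras (GBAs) are the commutative SBAs. The relation $\mathcal{D}$ is given by $x\mathrel{\mathcal{D}}y$ iff $x\wedge y\wedge x=x$ and $y\wedge x\wedge y=y$; it is a congruence on the reduct $(S;\wedge,\vee,\setminus,0)$,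 and $S/\mathcal{D}$ denotes the quotient of this reduct, a GBA. A $\mathcal{D}$-class is atomic if it is an atom (minimal non-zero element) of $S/\mathcal{D}$. An atom of $S$ is a minimal non-zero element of $S$ with respect to $\leq$. The center of $S$ is the set of elements $a$ with $a\wedge x=x\wedge a$ and $a\vee x=x\vee a$ for all $x\in S$ (equivalently, the union of the singleton $\mathcal{D}$-classes). For $m\geq 2$, $\mathbf{m}_L$ is the left-handed SBIA on $\{0,1,\dots,m-1\}$ with zero $0$ in which, for non-zero $a,b$: $a\wedge b=a$, $a\vee b=b$, $a\setminus b=0$, $a\sqcap a=a$ and $a\sqcap b=0$ if $a\neq b$ (with $a\setminus 0=a$, $0\setminus a=0$, and $0\sqcap a=a\sqcap 0=0$). $\mathbf{2}=\mathbf{2}_L$ is the two-element Boolean algebra. Powers and products are direct powers and direct products, and the isomorphism in (2) is one of SBIAs. The Bell number $B_m$ is the number of partitions of an $m$-element set into non-empty blocks, and $S(m,k)$ is the number of those with exactly $k$ blocks. *)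

(* Defs.v *)
From mathcomp Require Import all_boot.
From mathcomp Require Import boolp classical_sets functions cardinality.

Set Implicit Arguments.
Unset Strict Implicit.
Unset Printing Implicit Defensive.

Local Open Scope classical_set_scope.

Record sbaSig : Type := SbaSig {
  sba_sort :> Type;
  smeet : sba_sort -> sba_sort -> sba_sort;
  sjoin : sba_sort -> sba_sort -> sba_sort;
  sdiff : sba_sort -> sba_sort -> sba_sort;
  szero : sba_sort }.

Record sbiaSig : Type := SbiaSig {
  sba_reduct :> sbaSig;
  scap : sba_reduct -> sba_reduct -> sba_reduct }.

Arguments szero {s}.

Declare Scope sba_scope.
Delimit Scope sba_scope with sba.
Notation "x ∧ y" := (smeet x y) (at level 40, left associativity) : sba_scope.
Notation "x ∨ y" := (sjoin x y) (at level 40, left associativity) : sba_scope.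
Notation "x ∖ y" := (sdiff x y) (at level 40, left associativity) : sba_scope.
Notation "x ⊓ y" := (scap x y) (at level 40, left associativity) : sba_scope.
Notation "𝟘" := szero : sba_scope.
Local Open Scope sba_scope.

Record is_sba (S : sbaSig) : Prop := IsSba {
  smeetA : forall x y z : S, x ∧ (y ∧ z) = (x ∧ y) ∧ z;
  sjoinA : forall x y z : S, x ∨ (y ∨ z) = (x ∨ y) ∨ z;
  sjoin_meetK : forall x y : S, x ∨ (x ∧ y) = x;
  smeet_joinKr : forall x y : S, (y ∧ x) ∨ x = x;
  smeet_joinK : forall x y : S, x ∧ (x ∨ y) = x;
  sjoin_meetKr : forall x y : S, (y ∨ x) ∧ x = x;
  smeet_joinr : forall x y z : S, x ∧ (y ∨ z) = (x ∧ y) ∨ (x ∧ z);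
  smeet_joinl : forall x y z : S, (y ∨ z) ∧ x = (y ∧ x) ∨ (z ∧ x);
  sjoinx0 : forall x : S, x ∨ 𝟘 = x;
  sjoin0x : forall x : S, 𝟘 ∨ x = x;
  smeetx0 : forall x : S, x ∧ 𝟘 = 𝟘;
  smeet0x : forall x : S, 𝟘 ∧ x = 𝟘;
  sdiff_meet : forall x y : S, (x ∖ y) ∧ y = 𝟘;
  smeet_diff : forall x y : S, y ∧ (x ∖ y) = 𝟘;
  sdiff_joinl : forall x y : S, (x ∖ y) ∨ (x ∧ y ∧ x) = x;
  sdiff_joinr : forall x y : S, (x ∧ y ∧ x) ∨ (x ∖ y) = x;
  smeetACA : forall x y z t : S, x ∧ y ∧ z ∧ t = x ∧ z ∧ y ∧ t }.

Definition left_handed (S : sbaSig) : Prop :=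
  (forall x y : S, x ∧ y ∧ x = x ∧ y) /\ (forall x y : S, x ∨ y ∨ x = y ∨ x).

Definition nle (S : sbaSig) (x y : S) : Prop := x ∧ y = x /\ y ∧ x = x.

Definition is_glb (S : sbaSig) (x y z : S) : Prop :=
  [/\ nle z x, nle z y & forall t : S, nle t x -> nle t y -> nle t z].

Definition is_lh_sbia (S : sbiaSig) : Prop :=
  [/\ is_sba S, left_handed S & forall x y : S, is_glb x y (x ⊓ y)].

Definition is_gba (S : sbaSig) : Prop :=
  [/\ is_sba S, (forall x y : S, x ∧ y = y ∧ x)
    & forall x y : S, x ∨ y = y ∨ x].

Record sba_hom (A B : sbaSig) (h : A -> B) : Prop := SbaHom {
  hom_meet : forall x y, h (x ∧ y) = h x ∧ h y;
  hom_join : forall x y, h (x ∨ y) = h x ∨ h y;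
  hom_diff : forall x y, h (x ∖ y) = h x ∖ h y;
  hom_zero : h 𝟘 = 𝟘 }.

Definition sbia_hom (A B : sbiaSig) (h : A -> B) : Prop :=
  sba_hom h /\ forall x y, h (x ⊓ y) = h x ⊓ h y.

Definition sba_iso (A B : sbaSig) : Prop :=
  exists h : A -> B, sba_hom h /\ bijective h.

Definition sbia_iso (A B : sbiaSig) : Prop :=
  exists h : A -> B, sbia_hom h /\ bijective h.

Definition is_free_lh_sbia (X : Type) (F : sbiaSig) (g : X -> F) : Prop :=
  is_lh_sbia F /\
  forall A : sbiaSig, is_lh_sbia A -> forall f : X -> A,
    exists! h : F -> A, sbia_hom h /\ forall x, h (g x) = f x.

Definition is_free_gba (X : Type) (F : sbaSig) (g : X -> F) : Prop :=
  is_gba F /\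
  forall A : sbaSig, is_gba A -> forall f : X -> A,
    exists! h : F -> A, sba_hom h /\ forall x, h (g x) = f x.

(** The classes [R x] as elements of a type; this is the usual quotient when
    [R] is an equivalence relation. *)
Definition quot (T : Type) (R : T -> T -> Prop) : Type :=
  {C : set T | exists x, C = R x}.

Definition cls (T : Type) (R : T -> T -> Prop) (x : T) : quot R :=
  exist _ (R x) (ex_intro _ x erefl).

Definition repr (T : Type) (R : T -> T -> Prop) (C : quot R) : T :=
  sval (cid (svalP C)).

Definition Drel (S : sbaSig) (x y : S) : Prop :=
  x ∧ y ∧ x = x /\ y ∧ x ∧ y = y.

(** [S/D].  The operations are computed on chosen representatives; lemma
    [cls_Dquot_hom] below shows that the result does not depend on them. *)
Definition Dquot (S : sbaSig) : sbaSig :=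
  @SbaSig (quot (@Drel S))
    (fun C C' => cls _ (repr C ∧ repr C'))
    (fun C C' => cls _ (repr C ∨ repr C'))
    (fun C C' => cls _ (repr C ∖ repr C'))
    (cls _ 𝟘).

Definition is_atom (S : sbaSig) (x : S) : Prop :=
  x <> 𝟘 /\ forall y : S, y <> 𝟘 -> nle y x -> y = x.

(** [sval C] is the underlying subset of [S]. *)
Definition singleton_Dclass (S : sbaSig) (C : Dquot S) : Prop :=
  exists x : S, sval C = [set x].

Definition center (S : sbaSig) : set S :=
  [set a | forall x : S, a ∧ x = x ∧ a /\ a ∨ x = x ∨ a].
Arguments center S : clear implicits.

Record sba_closed (S : sbaSig) (C : set S) : Prop := SbaClosed {
  closed_meet : forall x y, C x -> C y -> C (x ∧ y);
  closed_join : forall x y, C x -> C y -> C (x ∨ y);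
  closed_diff : forall x y, C x -> C y -> C (x ∖ y);
  closed_zero : C 𝟘 }.

Definition sub_sba (S : sbaSig) (C : set S) (cC : sba_closed C) : sbaSig :=
  @SbaSig {x : S | C x}
    (fun x y => exist _ (sval x ∧ sval y) (closed_meet cC (svalP x) (svalP y)))
    (fun x y => exist _ (sval x ∨ sval y) (closed_join cC (svalP x) (svalP y)))
    (fun x y => exist _ (sval x ∖ sval y) (closed_diff cC (svalP x) (svalP y)))
    (exist _ 𝟘 (closed_zero cC)).

Definition prod_sbia (I : Type) (A : I -> sbiaSig) : sbiaSig :=
  @SbiaSig
    (@SbaSig (forall i, A i)
      (fun x y i => x i ∧ y i) (fun x y i => x i ∨ y i)
      (fun x y i => x i ∖ y i) (fun i => 𝟘))
    (fun x y i => x i ⊓ y i).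

Definition pow_sbia (A : sbiaSig) (N : nat) : sbiaSig :=
  prod_sbia (fun _ : 'I_N => A).

(** [mL m] is the algebra on [{0, ..., m-1}]; only [m >= 2] is meaningful, and
    for [m >= 1] the carrier is ['I_m] since then [m.-1.+1 = m]. *)
Definition mL (m : nat) : sbiaSig :=
  @SbiaSig
    (@SbaSig 'I_m.-1.+1
      (fun a b => if b == ord0 then ord0 else a)
      (fun a b => if b == ord0 then a else b)
      (fun a b => if b == ord0 then a else ord0)
      ord0)
    (fun a b => if a == b then a else ord0).

Definition bell (m : nat) : nat :=
  #|[pred P : {set {set 'I_m}} | finset.partition P [set: 'I_m]%SET]|.

Definition stirling2 (m k : nat) : nat :=
  #|[pred P : {set {set 'I_m}} | finset.partition P [set: 'I_m]%SET & #|P| == k]|.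

Lemma reprK (T : Type) (R : T -> T -> Prop) (C : quot R) : cls R (repr C) = C.
Proof.
case: C => C hC; apply: eq_exist => /=.
by rewrite /repr /=; case: cid => x /= ->.
Qed.

Lemma cls_eqP (T : Type) (R : T -> T -> Prop) :
  (forall x, R x x) -> (forall x y, R x y -> R y x) ->
  (forall y x z, R x y -> R y z -> R x z) ->
  forall x y, cls R x = cls R y <-> R x y.
Proof.
move=> rR sR tR x y; split=> [/(congr1 sval) /= e | xy].
  by rewrite e; exact: rR.
apply: eq_exist => /=; apply/funext => z; apply/propext; split.
  by apply: tR; apply: sR.
exact: tR.
Qed.

Definition Dle (S : sbaSig) (x y : S) : Prop := x ∧ y ∧ x = x.

Lemma smeetxx (S : sbaSig) (hS : is_sba S) (x : S) : x ∧ x = x.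
Proof. by rewrite -{2}(sjoin_meetK hS x x) (smeet_joinK hS). Qed.

Lemma Dle_trans (S : sbaSig) (hS : is_sba S) (y x z : S) :
  Dle x y -> Dle y z -> Dle x z.
Proof.
rewrite /Dle => xy yz.
have A := smeetA hS; have I := smeetxx hS; have N := smeetACA hS.
have e : x ∧ z ∧ y ∧ x = x.
  by rewrite -{3}xy -{2}yz !A (N x y z y) -(A (x ∧ z) y y) I.
by rewrite -{2}xy !A (N x z x y) I e.
Qed.

Lemma Dle_meet (S : sbaSig) (hS : is_sba S) (x y z t : S) :
  Dle x y -> Dle z t -> Dle (x ∧ z) (y ∧ t).
Proof.
rewrite /Dle => xy zt.
have A := smeetA hS; have N := smeetACA hS.
rewrite !A (N x z y t) -(A (x ∧ y) z t) (N (x ∧ y) (z ∧ t) x z) xy.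
by rewrite -(A x (z ∧ t) z) zt.
Qed.

Lemma Dle_join (S : sbaSig) (hS : is_sba S) (x y z t : S) :
  Dle x y -> Dle z t -> Dle (x ∨ z) (y ∨ t).
Proof.
have A := smeetA hS; have I := smeetxx hS; have N := smeetACA hS.
have L := smeet_joinl hS; have R := smeet_joinr hS.
have M (u v w : S) : Dle u v -> w ∧ v ∧ u = w ∧ u.
  by move=> uv; rewrite -{1}(I u) A (N w v u u) -!A (A u v u) uv.
have key (a b w : S) : Dle a w -> Dle b w -> Dle (a ∨ b) w.
  move=> aw bw; rewrite /Dle -[RHS]I !R !L !I aw bw.
  by rewrite (M _ _ _ aw) (M _ _ _ bw).
have le_joinl (a b : S) : Dle a (a ∨ b).
  by rewrite /Dle (smeet_joinK hS) I.
have le_joinr (a b : S) : Dle a (b ∨ a).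
  by rewrite /Dle -A (sjoin_meetKr hS) I.
move=> xy zt; apply: key.
  exact: (Dle_trans hS xy).
exact: (Dle_trans hS zt).
Qed.

Lemma Dle_diff (S : sbaSig) (hS : is_sba S) (x y z t : S) :
  Dle x y -> Dle t z -> Dle (x ∖ z) (y ∖ t).
Proof.
have A := smeetA hS; have I := smeetxx hS; have N := smeetACA hS.
rewrite /Dle => xy tz; set u := x ∖ z.
have ux : u ∧ x = u.
  by rewrite -{1}(sdiff_joinl hS x z) -/u (smeet_joinK hS).
have xu : x ∧ u = u.
  by rewrite -{1}(sdiff_joinr hS x z) -/u (sjoin_meetKr hS).
have uyu : u ∧ y ∧ u = u.
  by rewrite -{1}ux -{2}xu !A -(A u x y) -(A u (x ∧ y) x) xy ux I.
have ut : u ∧ t = 𝟘.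
  rewrite -tz !A (N u t z t) (sdiff_meet hS) !(smeet0x hS) //.
rewrite -[RHS]uyu -[in RHS](sdiff_joinl hS y t) (smeet_joinr hS) (smeet_joinl hS).
rewrite !A (N u y t y) ut !(smeet0x hS).
by rewrite (sjoinx0 hS).
Qed.

Lemma cls_Dquot_eq (S : sbaSig) (hS : is_sba S) (x y : S) :
  cls (@Drel S) x = cls (@Drel S) y <-> Drel x y.
Proof.
apply: cls_eqP => [a|a b [] //|b a c [ab ba] [bc cb]].
  by split; rewrite !(smeetxx hS).
by split; apply: (Dle_trans hS) (b) _ _ _ _.
Qed.

Lemma cls_Dquot_hom (S : sbaSig) (hS : is_sba S) :
  @sba_hom S (Dquot S) (cls (@Drel S)).
Proof.
have rD (x : S) : Drel x (repr (cls (@Drel S) x)).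
  by apply/(cls_Dquot_eq hS); rewrite reprK.
split=> [x y|x y|x y|//]; apply/(cls_Dquot_eq hS);
  have [x1 x2] := rD x; have [y1 y2] := rD y; split.
- exact: (Dle_meet hS).
- exact: (Dle_meet hS).
- exact: (Dle_join hS).
- exact: (Dle_join hS).
- exact: (Dle_diff hS).
- exact: (Dle_diff hS).
Qed.

Inductive term (X : Type) : Type :=
  | Var of X
  | Zero
  | Meet of term X & term X
  | Join of term X & term X
  | Diff of term X & term X
  | Cap of term X & term X.

Arguments Zero {X}.

Fixpoint teval (X : Type) (A : sbiaSig) (f : X -> A) (t : term X) : A :=
  match t with
  | Var x => f x
  | Zero => 𝟘
  | Meet s t => teval f s ∧ teval f t
  | Join s t => teval f s ∨ teval f t
  | Diff s t => teval f s ∖ teval f t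
  | Cap s t => teval f s ⊓ teval f t
  end.

Definition teq (K : sbiaSig -> Prop) (X : Type) (s t : term X) : Prop :=
  forall A : sbiaSig, K A -> forall f : X -> A, teval f s = teval f t.

Definition free_alg (K : sbiaSig -> Prop) (X : Type) : sbiaSig :=
  let op F C C' := cls (@teq K X) (F (repr C) (repr C')) in
  @SbiaSig
    (@SbaSig (quot (@teq K X)) (op (@Meet X)) (op (@Join X)) (op (@Diff X))
      (cls _ Zero))
    (op (@Cap X)).

Definition free_gen (K : sbiaSig -> Prop) (X : Type) (x : X) : free_alg K X :=
  cls _ (Var x).

Definition free_ext (K : sbiaSig -> Prop) (X : Type) (A : sbiaSig)
  (f : X -> A) (C : free_alg K X) : A := teval f (repr C).

Lemma free_extE (K : sbiaSig -> Prop) (X : Type) (A : sbiaSig) (f : X -> A) :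
  K A -> forall t, free_ext f (cls (@teq K X) t) = teval f t.
Proof.
move=> KA t; suff : teq K (repr (cls (@teq K X) t)) t by exact.
apply/(@cls_eqP _ (@teq K X)); rewrite ?reprK //.
- by move=> a b ab B KB h; rewrite ab.
- by move=> b a c ab bc B KB h; rewrite ab // bc.
Qed.

Lemma free_ext_hom (K : sbiaSig -> Prop) (X : Type) (A : sbiaSig)
  (f : X -> A) : K A -> sbia_hom (@free_ext K X A f).
Proof.
by move=> KA; split=> [|x y]; [split=> [x y|x y|x y|] |]; apply: free_extE.
Qed.

Lemma free_ext_inj (K : sbiaSig -> Prop) (X : Type) (C C' : free_alg K X) :
  (forall A, K A -> forall f : X -> A, free_ext f C = free_ext f C') -> C = C'.
Proof.
move=> e; rewrite -(reprK C) -(reprK C'); apply/cls_eqP => //.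
- by move=> a b ab B KB h; rewrite ab.
- by move=> b a c ab bc B KB h; rewrite ab // bc.
Qed.

Lemma free_ext_unique (K : sbiaSig -> Prop) (X : Type) (A : sbiaSig)
  (f : X -> A) (h : free_alg K X -> A) : K A -> sbia_hom h ->
  (forall x, h (free_gen K x) = f x) -> free_ext f = h.
Proof.
move=> KA [[hM hJ hD h0] hC] hf; apply/funext => C; rewrite -(reprK C).
rewrite free_extE //; move: (repr C) => t {C}.
have E (F : term X -> term X -> term X) s u :
    (forall (B : sbiaSig) (k : X -> B) a b a' b', teval k a = teval k a' ->
       teval k b = teval k b' -> teval k (F a b) = teval k (F a' b')) ->
    cls (@teq K X) (F s u) =
    cls _ (F (repr (cls (@teq K X) s)) (repr (cls (@teq K X) u))).
  move=> hF; apply: free_ext_inj => B KB k; rewrite !free_extE //.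
  by apply: hF; rewrite -(free_extE k KB).
elim: t => [x|//|s IHs t IHt|s IHs t IHt|s IHs t IHt|s IHs t IHt] /=.
- by rewrite -hf.
- by rewrite IHs IHt -hM (E (@Meet X)) // => B k a b a' b' /= -> ->.
- by rewrite IHs IHt -hJ (E (@Join X)) // => B k a b a' b' /= -> ->.
- by rewrite IHs IHt -hD (E (@Diff X)) // => B k a b a' b' /= -> ->.
- by rewrite IHs IHt -hC (E (@Cap X)) // => B k a b a' b' /= -> ->.
Qed.

Lemma free_is_sba (K : sbiaSig -> Prop) (X : Type) :
  (forall A, K A -> is_sba A) -> is_sba (free_alg K X).
Proof.
move=> hK; split=> *; apply: free_ext_inj => A KA f;
  have [[hM hJ hD h0] _] := free_ext_hom f KA; have hA := hK A KA;
  rewrite ?(hM, hJ, hD, h0).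
- exact: smeetA.
- exact: sjoinA.
- exact: sjoin_meetK.
- exact: smeet_joinKr.
- exact: smeet_joinK.
- exact: sjoin_meetKr.
- exact: smeet_joinr.
- exact: smeet_joinl.
- exact: sjoinx0.
- exact: sjoin0x.
- exact: smeetx0.
- exact: smeet0x.
- exact: sdiff_meet.
- exact: smeet_diff.
- exact: sdiff_joinl.
- exact: sdiff_joinr.
- exact: smeetACA.
Qed.

Lemma free_lh_sbia_exists (X : Type) :
  exists (F : sbiaSig) (g : X -> F), is_free_lh_sbia g.
Proof.
exists (free_alg is_lh_sbia X), (@free_gen _ X); split; last first.
  move=> A hA f; exists (free_ext f); split.
    by split=> [|x]; [exact: free_ext_hom | exact: free_extE].
  by move=> h [hh hf]; exact: free_ext_unique.
split; first by apply: free_is_sba => A [].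
  split=> x y; apply: free_ext_inj => A KA f;
    have [[hM hJ _ _] _] := free_ext_hom f KA; have [_ [l1 l2] _] := KA;
    by rewrite ?(hM, hJ) ?l1 ?l2.
have nleP (x y : free_alg is_lh_sbia X) : nle x y <->
    forall A, is_lh_sbia A -> forall f : X -> A,
      nle (free_ext f x) (free_ext f y).
  split=> [[xy yx] A KA f | xy].
    by have [[hM _ _ _] _] := free_ext_hom f KA; split; rewrite -hM ?xy ?yx.
  split; apply: free_ext_inj => A KA f; have [[hM _ _ _] _] := free_ext_hom f KA;
    by rewrite hM; case: (xy A KA f).
move=> x y; split=> [||t /nleP tx /nleP ty]; apply/nleP => A KA f;
  have [_ hC] := free_ext_hom f KA; rewrite hC; have [_ _ /(_ (free_ext f x))] := KA;
  move=> /(_ (free_ext f y)) [cx cy cg] //.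
by apply: cg; [exact: tx | exact: ty].
Qed.

Lemma free_gba_exists (X : Type) :
  exists (F : sbaSig) (g : X -> F), is_free_gba g.
Proof.
(* A GBA is regarded as an algebra in the larger signature with ⊓ := ∧. *)
pose K (A : sbiaSig) := is_gba A /\ forall x y : A, x ⊓ y = x ∧ y.
exists (free_alg K X), (@free_gen K X); split; last first.
  move=> A hA f; pose A' := @SbiaSig A (@smeet A).
  have KA : K A' by split.
  have capE (x y : free_alg K X) : x ⊓ y = x ∧ y.
    apply: free_ext_inj => B KB k; have [[-> _ _ _] ->] := free_ext_hom k KB.
    exact: (proj2 KB).
  exists (@free_ext K X A' f); split.
    by split=> [|x]; [exact: (proj1 (free_ext_hom _ KA)) | exact: (free_extE _ KA)].
  move=> h [hh hf]; apply: (@free_ext_unique K X A') => //.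
  by split=> // x y; rewrite capE; exact: hom_meet.
split; first by apply: free_is_sba => A [[]].
all: move=> x y; apply: free_ext_inj => A KA f;
  have [[hM hJ _ _] _] := free_ext_hom f KA; have [[_ c1 c2] _] := KA.
- by rewrite !hM c1.
- by rewrite !hJ c2.
Qed.

(* Main.v *)
Require Import Defs.
From mathcomp Require Import all_boot perm.

(* Meeting with an element [e] and subtracting [e] are two endomorphisms of a
   left-handed skew Boolean intersection algebra which jointly separate points.
   Applying them for all [e = f x ⊓ f y], with [f] an assignment of the
   generators, separates any two distinct values of terms by an endomorphism
   [h] for which every [h (f x) ⊓ h (f y)] is zero or a top element.  The
   nonzero values of such an assignment [h \o f] form, with [0], a copy of an
   algebra [mL m], and up to renaming the assignment is determined by its
   kernel together with its zero set, that is, by a partition of the set of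
   generators extended by one point.  Hence the free algebra is the subalgebra
   of the product of the [mL #|P|] over these partitions [P] generated by the
   tautological assignment, and this subalgebra is everything because products
   of meets and differences with the [x ⊓ y] isolate a single factor. *)

Set Implicit Arguments.
Unset Strict Implicit.
Unset Printing Implicit Defensive.

(** * Counting set partitions *)

Section AddPoint.
Variable m : nat.
Implicit Types (P : {set {set 'I_m}}) (b c : {set 'I_m}).
Implicit Types (Q : {set {set 'I_m.+1}}) (B : {set 'I_m.+1}).

Notation l := (lift (@ord0 m)).

Let l_inj : injective l := @lift_inj _ ord0.

Lemma ord0_notin_lift b : (ord0 \in l @: b) = false.
Proof. by apply/negP => /imsetP[x _ /eqP]; rewrite (negPf (neq_lift _ _)). Qed.

Lemma preim_lift_im0 b : l @^-1: (ord0 |: l @: b) = b.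
Proof.
by apply/setP => x; rewrite !inE mem_imset // eq_sym (negPf (neq_lift _ _)).
Qed.

Lemma im_preim_lift B : ord0 \notin B -> l @: (l @^-1: B) = B.
Proof.
move=> n0; apply/setP => x; case: (unliftP ord0 x) => [y|] ->.
  by rewrite mem_imset // inE.
by rewrite ord0_notin_lift (negPf n0).
Qed.

Lemma im0_preim_lift B : ord0 \in B -> ord0 |: l @: (l @^-1: B) = B.
Proof.
move=> B0; apply/setP => x; rewrite inE; case: (unliftP ord0 x) => [y|] ->.
  by rewrite mem_imset // !inE eq_sym (negPf (neq_lift _ _)).
by rewrite inE eqxx B0.
Qed.

Lemma setC_lift B : ord0 \in B -> ~: B = l @: (~: (l @^-1: B)).
Proof. by move=> B0; rewrite -preimsetC im_preim_lift // inE B0. Qed.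

(* [extend P b] adds the new point to the block [b] of [P], or as a singleton
   block when [b] is empty. *)
Definition extend P b : {set {set 'I_m.+1}} :=
  (ord0 |: l @: b) |: [set l @: c | c : {set 'I_m} in P :\ b].

Lemma partition_setD1 P b : partition P [set: 'I_m] -> b \in set0 |: P ->
  partition (P :\ b) (~: b).
Proof.
move=> hP; rewrite !inE => /predU1P[->|bP]; last first.
  by rewrite -setTD; exact: partitionD1.
by rewrite setC0 (setDidPl _) // disjoint_sym disjoints1 (partition0 hP).
Qed.

Lemma extend_partition P b : partition P [set: 'I_m] -> b \in set0 |: P ->
  partition (extend P b) [set: 'I_m.+1].
Proof.
move=> hP bP; have n0 : ord0 |: l @: b != set0.
  by apply/set0Pn; exists ord0; rewrite !inE eqxx.
have eD : ~: (ord0 |: l @: b) = l @: (~: b).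
  by rewrite setC_lift ?preim_lift_im0 // !inE eqxx.
rewrite -(setUCr (ord0 |: l @: b)) eD; apply: partitionU1 n0 _.
  by rewrite imset_partition //; exact: partition_setD1.
by rewrite -eD -setI_eq0 setICr.
Qed.

Lemma extendD1 P b :
  extend P b :\ (ord0 |: l @: b) = [set l @: c | c : {set 'I_m} in P :\ b].
Proof.
rewrite setU1K //; apply/negP => /imsetP[c _ e].
by have := ord0_notin_lift c; rewrite -e !inE eqxx.
Qed.

(** The block of [ord0] gives back [b] by pulling back along [lift], and the other blocks give back
    [P :\ b]. Whether [b] itself is a block of [P] depends only on whether it is empty. *)
Lemma extend_inj P P' b b' :
    partition P [set: 'I_m] -> b \in set0 |: P ->
    partition P' [set: 'I_m] -> b' \in set0 |: P' ->
  extend P b = extend P' b' -> P = P' /\ b = b'.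
Proof.
move=> hP bP hP' bP' e; have eb : b = b'.
  have : ord0 |: l @: b \in extend P' b' by rewrite -e setU11.
  rewrite inE => /orP[/set1P eb|/imsetP[c _ e0]].
    by rewrite -(preim_lift_im0 b) eb preim_lift_im0.
  by have := ord0_notin_lift c; rewrite -e0 !inE eqxx.
split=> //; move: bP bP'; rewrite -eb in e * => bP bP'.
have eD : P :\ b = P' :\ b.
  apply: (imset_inj (imset_inj l_inj)).
  by rewrite -[LHS]extendD1 -[RHS]extendD1 e.
apply/setP => c; have [->|nc] := eqVneq c b; last first.
  by have /setP/(_ c) := eD; rewrite !inE nc.
have [b0|nb] := eqVneq b set0.
  by rewrite b0 (partition0 hP) (partition0 hP').
by move: bP bP'; rewrite !inE (negPf nb) /= => -> ->.
Qed.

(** Pulling blocks back along [lift] restricts [Q] to the old points. The set [b] is the trace of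
    the block of [ord0], empty when that block is a singleton. *)
Lemma extend_surj Q : partition Q [set: 'I_m.+1] -> exists P b,
  [/\ partition P [set: 'I_m], b \in set0 |: P & extend P b = Q].
Proof.
move=> hQ; have c0 : ord0 \in cover Q by rewrite (cover_partition hQ) inE.
set B := pblock Q ord0; have B0 : ord0 \in B by rewrite mem_pblock.
have BQ : B \in Q by rewrite pblock_mem.
pose b := l @^-1: B; pose P' := [set l @^-1: C | C : {set 'I_m.+1} in Q :\ B].
have hQ1 : partition (Q :\ B) (~: B) by rewrite -setTD; exact: partitionD1.
have imP' : [set l @: c | c : {set 'I_m} in P'] = Q :\ B.
  rewrite -imset_comp -[RHS]imset_id; apply: eq_in_imset => C CQ /=.
  by apply/im_preim_lift/negP => /(subsetP (partitionS hQ1 CQ)); rewrite inE B0.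
have hP' : partition P' (~: b).
  by rewrite -(imset_partition _ _ l_inj) imP' -setC_lift.
have bP' : b \notin P'.
  apply/negP => bP'; have /set0Pn[x xb] := partition_neq0 hP' bP'.
  by have /subsetP/(_ x xb) := partitionS hP' bP'; rewrite inE xb.
have extE P : P :\ b = P' -> extend P b = Q.
  by move=> e; rewrite /extend e imP' im0_preim_lift // setD1K.
have [b0|nb] := eqVneq b set0.
  exists P', b; split; last 1 first.
  - by apply: extE; rewrite (setDidPl _) // disjoint_sym disjoints1.
  - by rewrite b0 setC0 in hP'.
  - by rewrite b0 setU11.
exists (b |: P'), b; split; last 1 first.
- by apply: extE; rewrite setU1K.
- rewrite -(setUCr b); apply: partitionU1 => //.
  by rewrite -setI_eq0 setICr.
- by rewrite !inE eqxx orbT.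
Qed.

Lemma bellE k : bell k = \sum_(P : {set {set 'I_k}} | partition P [set: 'I_k]) 1.
Proof. by rewrite sum1_card. Qed.

(** Each [P] has [#|P|.+1] extensions: the new point joins one of the blocks or forms its own. *)
Lemma bell_rec :
  bell m.+1 = \sum_(P : {set {set 'I_m}} | partition P [set: 'I_m]) #|P|.+1.
Proof.
pose D := [set Pb : {set {set 'I_m}} * {set 'I_m} |
  partition Pb.1 [set: 'I_m] & Pb.2 \in set0 |: Pb.1].
transitivity #|[set extend Pb.1 Pb.2 | Pb in D]|.
  apply: eq_card => Q; rewrite [LHS]inE; apply/idP/imsetP.
    case/extend_surj=> P [b [hP bP e]].
    by exists (P, b); rewrite // inE hP.
  by case=> -[P b] /[!inE] /= /andP[hP bP] ->; apply: extend_partition; rewrite ?inE.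
rewrite card_in_imset; last first.
  move=> [P b] [P' b'] /[!inE] /= /andP[hP bP] /andP[hP' bP'] e.
  by have [] := @extend_inj P P' b b' hP _ hP' _ e; rewrite ?inE // => -> ->.
transitivity (\sum_(P : {set {set 'I_m}} | partition P [set: 'I_m])
    \sum_(b in set0 |: P) 1).
  by rewrite pair_big_dep -sum1_card; apply: eq_bigl => Pb; rewrite inE.
by apply: eq_bigr => P hP; rewrite sum1_card cardsU1 (partition0 hP).
Qed.

(** A two-block partition is determined by its block avoiding [ord0], which is the image under
    [lift] of an arbitrary non-empty set. *)
Lemma stirling2_2 : stirling2 m.+1 2 = 2 ^ m - 1.
Proof.
have n0 b : ord0 \in ~: (l @: b) by rewrite inE ord0_notin_lift.
transitivity
  #|[set [set l @: b; ~: (l @: b)] | b : {set 'I_m} in [set~ set0]]|; last first.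
  rewrite card_in_imset; last first.
    move=> b b' _ _ e; have : l @: b \in [set l @: b'; ~: (l @: b')].
      by rewrite -e !inE eqxx.
    rewrite !inE => /orP[/eqP/(imset_inj l_inj) // | /eqP e'].
    by have := n0 b'; rewrite -e' ord0_notin_lift.
  by rewrite cardsC1 -cardsT -powersetT card_powerset cardsT card_ord subn1.
apply: eq_card => Q; rewrite inE; apply/andP/imsetP => [[hQ /cards2P]|[b]].
  case=> A [B]; wlog B0 : A B / ord0 \in B => [W [AB QE]|[AB QE]].
    have : ord0 \in cover Q by rewrite (cover_partition hQ) inE.
    rewrite {1}QE /cover bigcup_setU !big_set1 inE => /orP[] h0.
      by apply: (W B A h0); rewrite eq_sym setUC.
    exact: (W A B h0 (conj AB QE)).
  have AQ : A \in Q by rewrite QE !inE eqxx.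
  have BQ : B \in Q by rewrite QE !inE eqxx orbT.
  have tI := trivIsetP (partition_trivIset hQ) A B AQ BQ AB.
  have BE : B = ~: A.
    apply/eqP; rewrite eqEsubset -disjoints_subset disjoint_sym tI /=.
    have := cover_partition hQ; rewrite QE /cover bigcup_setU !big_set1 => /setP AB1.
    by apply/subsetP => x; have := AB1 x; rewrite !inE => /orP[->|].
  have A0 : ord0 \notin A by move: B0; rewrite BE inE.
  exists (l @^-1: A); last by rewrite im_preim_lift // QE BE.
  rewrite !inE; apply: contraTneq (partition_neq0 hQ AQ) => A'.
  by rewrite -(im_preim_lift A0) A' imset0 eqxx.
rewrite !inE => nb ->; split.
  have p1 (C : {set 'I_m.+1}) : C != set0 -> partition [set C] C.
    move=> nC; rewrite -[[set C]]setU0 -[X in partition _ X]setU0.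
    apply: partitionU1 => //.
      by rewrite partition_set0.
    by rewrite disjoint_sym disjoints_subset sub0set.
  rewrite -(setUCr (l @: b)); apply: partitionU1; rewrite ?imset_eq0 //.
    by apply: p1; apply/set0Pn; exists ord0.
  by rewrite -setI_eq0 setICr.
rewrite cards2; have [e|//] := eqVneq (l @: b).
by have := n0 b; rewrite -e ord0_notin_lift.
Qed.

Lemma partition1 Q : partition Q [set: 'I_m.+1] ->
  (#|Q| <= 1) = (Q == [set [set: 'I_m.+1]]).
Proof.
move=> hQ; apply/idP/eqP => [|->]; last by rewrite cards1.
rewrite leq_eqVlt ltnS leqn0 => /orP[/cards1P[A QE]|]; last first.
  rewrite cards_eq0 => /eqP Q0; have := cover_partition hQ.
  by rewrite Q0 /cover big_set0 => /setP/(_ ord0); rewrite !inE.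
by have := cover_partition hQ; rewrite QE /cover big_set1 => ->.
Qed.

Lemma setT_partition : partition [set [set: 'I_m.+1]] [set: 'I_m.+1].
Proof.
rewrite -[X in partition X]setU0 -[X in partition _ X]setU0.
apply: partitionU1; rewrite ?partition_set0 //.
  by apply/set0Pn; exists ord0; rewrite inE.
by rewrite disjoint_sym disjoints_subset sub0set.
Qed.

End AddPoint.

(* Imported only now because [classical_sets] shadows many names of [finset]. *)
From mathcomp Require Import boolp classical_sets functions cardinality.

Local Open Scope classical_set_scope.
Local Open Scope card_scope.
Local Open Scope sba_scope.

(** * Separating endomorphisms and free algebras *)

Section LeftHandedSba.
Variables (S : sbaSig) (hS : is_sba S) (lS : left_handed S).
Implicit Types x y z u v w e : S.

Let A := smeetA hS.
Let I := smeetxx hS.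
Let N := smeetACA hS.

(** The normal law permutes only inner factors. Left-handedness allows a further [x] to be appended
    on the right and removed after the swap. *)
Lemma lh_meetC x y z : x ∧ y ∧ z = x ∧ z ∧ y.
Proof.
have [l _] := lS.
by rewrite -A -l !A N -[RHS]A -[RHS]l !A.
Qed.

(** By distributivity both sides equal [(u ∨ v) ∧ (v ∨ u)], the mixed meets being zero. *)
Lemma join_orthC u v : u ∧ v = 𝟘 -> v ∧ u = 𝟘 -> u ∨ v = v ∨ u.
Proof.
move=> uv vu; have L := smeet_joinl hS; have R := smeet_joinr hS.
rewrite -[LHS](sjoinx0 hS).
transitivity ((u ∨ v) ∧ (v ∨ u)).
  by rewrite L !R uv vu !I (sjoin0x hS) !(sjoinx0 hS).
by rewrite R !L uv vu !I (sjoin0x hS) !(sjoinx0 hS).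
Qed.

(** Both [z] and [x ∖ y] are below [x] and orthogonal to [y]. Expanding [x] in [z ∧ x] and in
    [x ∧ (x ∖ y)] shows that each of them equals [z ∧ (x ∖ y)]. *)
Lemma diff_unique x y z : z ∧ y = 𝟘 -> y ∧ z = 𝟘 ->
  z ∨ (x ∧ y) = x -> (x ∧ y) ∨ z = x -> z = x ∖ y.
Proof.
have [l _] := lS; have L := smeet_joinl hS; have R := smeet_joinr hS.
move=> zy yz e1 e2; set u := x ∖ y.
have d1 : u ∨ (x ∧ y) = x by rewrite -{2}(sdiff_joinl hS x y) l.
have d2 : (x ∧ y) ∨ u = x by rewrite -{2}(sdiff_joinr hS x y) l.
have uy : u ∧ y = 𝟘 := sdiff_meet hS x y.
have yu : y ∧ u = 𝟘 := smeet_diff hS x y.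
have ux : u ∧ x = u by rewrite -{1}d1 (smeet_joinK hS).
have xu : x ∧ u = u by rewrite -{1}d2 (sjoin_meetKr hS).
have zx : z ∧ x = z by rewrite -{1}e1 (smeet_joinK hS).
have xz : x ∧ z = z by rewrite -{1}e2 (sjoin_meetKr hS).
have zu : z ∧ u = z.
  by rewrite -[RHS]zx -d1 R A zx zy (sjoinx0 hS).
by rewrite -zu -[in RHS]xu -{1}e1 L -A yu (smeetx0 hS) (sjoinx0 hS).
Qed.

Lemma diff_joinE x e : (x ∖ e) ∨ (x ∧ e) = x.
Proof. by have [l _] := lS; rewrite -{3}(sdiff_joinl hS x e) l. Qed.

Lemma join_diffE x e : (x ∧ e) ∨ (x ∖ e) = x.
Proof. by have [l _] := lS; rewrite -{3}(sdiff_joinr hS x e) l. Qed.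

Lemma diff_nle x e : nle (x ∖ e) x.
Proof.
split; first by rewrite -{2}(diff_joinE x e) (smeet_joinK hS).
by rewrite -{1}(join_diffE x e) (sjoin_meetKr hS).
Qed.

Lemma meet_nle x e : nle (x ∧ e) x.
Proof. by have [l _] := lS; split; [exact: l | rewrite A I]. Qed.

Lemma nle_trans x y z : nle x y -> nle y z -> nle x z.
Proof.
move=> [xy yx] [yz zy]; split; first by rewrite -xy -A yz.
by rewrite -yx A zy.
Qed.

Lemma nle_anti x y : nle x y -> nle y x -> x = y.
Proof. by move=> [xy yx] [xy' _]; rewrite -yx. Qed.

Lemma diff0x e : 𝟘 ∖ e = 𝟘 :> S.
Proof. by have [<- _] := diff_nle 𝟘 e; rewrite (smeetx0 hS). Qed.

Lemma diffxx x : x ∖ x = 𝟘 :> S.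
Proof. by have [<- _] := diff_nle x x; rewrite (sdiff_meet hS). Qed.

Lemma diff_id x e : x ∧ e = 𝟘 -> x ∖ e = x.
Proof. by move=> xe; rewrite -{2}(diff_joinE x e) xe (sjoinx0 hS). Qed.

(** By uniqueness of differences it suffices to split [x] and [y] into their parts inside and
    outside [e]; the mixed meets vanish. *)
Lemma diff_meetl x y e : (x ∧ y) ∖ e = (x ∖ e) ∧ (y ∖ e).
Proof.
have L := smeet_joinl hS; have R := smeet_joinr hS.
have xye : x ∧ e ∧ (y ∧ e) = x ∧ y ∧ e by rewrite !A (lh_meetC x e) -A I.
have m0 a b : a ∧ e ∧ (b ∖ e) = 𝟘.
  by rewrite -A (smeet_diff hS) (smeetx0 hS).
have d0 a b : (a ∖ e) ∧ (b ∧ e) = 𝟘.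
  by rewrite A lh_meetC (sdiff_meet hS) (smeet0x hS).
apply/esym/diff_unique.
- by rewrite -A (sdiff_meet hS) (smeetx0 hS).
- by rewrite A (smeet_diff hS) (smeet0x hS).
- rewrite -[in RHS](diff_joinE x e) -[in RHS](diff_joinE y e) L !R m0 d0 xye.
  by rewrite (sjoinx0 hS) (sjoin0x hS).
- rewrite -[in RHS](join_diffE x e) -[in RHS](join_diffE y e) L !R m0 d0 xye.
  by rewrite (sjoinx0 hS) (sjoin0x hS).
Qed.

Lemma diff_joinl x y e : (x ∨ y) ∖ e = (x ∖ e) ∨ (y ∖ e).
Proof.
have L := smeet_joinl hS; have R := smeet_joinr hS; have J := sjoinA hS.
(* Regrouping the two splittings exchanges a part outside [e] with one inside; these are orthogonal,
   so their join commutes. *)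
have c a b : (a ∖ e) ∨ (b ∧ e) = (b ∧ e) ∨ (a ∖ e).
  apply: join_orthC; first by rewrite A lh_meetC (sdiff_meet hS) (smeet0x hS).
  by rewrite -A (smeet_diff hS) (smeetx0 hS).
apply/esym/diff_unique.
- by rewrite L !(sdiff_meet hS) (sjoinx0 hS).
- by rewrite R !(smeet_diff hS) (sjoinx0 hS).
- by rewrite L J -(J (x ∖ e)) c J diff_joinE -J diff_joinE.
- by rewrite L J -(J (x ∧ e)) -c J join_diffE -J join_diffE.
Qed.

End LeftHandedSba.

Section Retractions.
Variables (S : sbiaSig) (hS : is_lh_sbia S).
Implicit Types x y z e : S.

Let sS : is_sba S := let: And3 h _ _ := hS in h.
Let lS : left_handed S := let: And3 _ h _ := hS in h.

Lemma cap_unique x y z : is_glb x y z -> x ⊓ y = z.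
Proof.
have [_ _ /(_ x y) [cx cy cg]] := hS => -[zx zy zg].
by apply: nle_anti; [exact: zg | exact: cg].
Qed.

Lemma capxx x : x ⊓ x = x.
Proof. by apply: cap_unique; split=> //; split; rewrite (smeetxx sS). Qed.

(* A map preserving [∧], [∨] and [0] preserves [∖] because differences are
   unique, and a projection onto a down-closed set preserves meets. *)
Lemma retraction_hom (p : S -> S) :
    (forall x y, p (x ∧ y) = p x ∧ p y) ->
    (forall x y, p (x ∨ y) = p x ∨ p y) -> p 𝟘 = 𝟘 ->
    (forall x, nle (p x) x) -> (forall t x, nle t (p x) -> p t = t) ->
  sbia_hom p.
Proof.
move=> pM pJ p0 px pt; split; last first.
  move=> x y; apply/esym/cap_unique.
  have [_ _ /(_ x y) [cx cy cg]] := hS.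
  have mono a b : nle a b -> nle (p a) (p b).
    by move=> [ab ba]; split; rewrite -pM ?ab ?ba.
  split; [exact: mono | exact: mono | move=> t tx ty].
  rewrite -(pt _ _ tx); apply/mono/cg; first exact: (nle_trans sS tx).
  exact: (nle_trans sS ty).
split=> // x y; apply: (diff_unique sS lS); rewrite -!(pM, pJ).
- by rewrite (sdiff_meet sS).
- by rewrite (smeet_diff sS).
- by rewrite (diff_joinE sS lS).
- by rewrite (join_diffE sS lS).
Qed.

Lemma meet_hom e : sbia_hom (fun x => x ∧ e).
Proof.
have AA := smeetA sS; apply: retraction_hom => //.
- by move=> x y; rewrite !AA (lh_meetC sS lS x e) -[RHS]AA (smeetxx sS).
- by move=> x y; rewrite (smeet_joinl sS).
- by rewrite (smeet0x sS).
- by move=> x; exact: meet_nle.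
- by move=> t x [tx _] /=; rewrite -tx -!AA (smeetxx sS).
Qed.

Lemma diff_hom_r e : sbia_hom (fun x => x ∖ e).
Proof.
apply: retraction_hom => //.
- by move=> x y; exact: diff_meetl.
- by move=> x y; exact: diff_joinl.
- exact: diff0x.
- by move=> x; exact: diff_nle.
- move=> t x [tx _]; apply: (diff_id sS lS).
  by rewrite -tx -(smeetA sS) (sdiff_meet sS) (smeetx0 sS).
Qed.

Lemma meet_diff_inj e x y : x ∧ e = y ∧ e -> x ∖ e = y ∖ e -> x = y.
Proof.
by move=> m d; rewrite -(diff_joinE sS lS x e) -(diff_joinE sS lS y e) m d.
Qed.

End Retractions.

Lemma sbia_hom_comp (A B C : sbiaSig) (h : A -> B) (k : B -> C) :
  sbia_hom h -> sbia_hom k -> sbia_hom (k \o h).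
Proof.
move=> [[hM hJ hD h0] hC] [[kM kJ kD k0] kC]; split; first split.
all: by move=> *; rewrite /= ?(hM, hJ, hD, h0, hC, kM, kJ, kD, k0, kC).
Qed.

Lemma teval_hom (X : Type) (A B : sbiaSig) (h : A -> B) (f : X -> A) t :
  sbia_hom h -> teval (h \o f) t = h (teval f t).
Proof.
move=> [[hM hJ hD h0] hC].
by elim: t => //= s -> t ->; rewrite ?(hM, hJ, hD, hC).
Qed.

(* Relative to [f], the element [f x ⊓ f y] is zero or lies above everything. *)
Definition decided (S : sbiaSig) (X : Type) (f : X -> S) (p : X * X) : Prop :=
  f p.1 ⊓ f p.2 = 𝟘 \/ forall z, f z ∧ (f p.1 ⊓ f p.2) = f z.

Lemma decided_hom (S T : sbiaSig) (X : Type) (h : S -> T) (f : X -> S) p :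
  sbia_hom h -> decided f p -> decided (h \o f) p.
Proof.
move=> [[hM hJ hD h0] hC] [e|e]; [left | right => z]; rewrite /= -hC ?e //.
by rewrite -hM e.
Qed.

Lemma separating_endo (S : sbiaSig) (hS : is_lh_sbia S) (X : eqType)
    (f : X -> S) (L : seq (X * X)) (a b : S) : a <> b ->
  exists h : S -> S, [/\ sbia_hom h, h a <> h b &
    forall p, p \in L -> decided (h \o f) p].
Proof.
have [sS lS _] := hS; move=> ab; elim: L => [|p L [h [hh hab hL]]].
  by exists id.
pose e := h (f p.1) ⊓ h (f p.2).
suff [k [kk kab kp]] : exists k : S -> S, [/\ sbia_hom k, k (h a) <> k (h b)
    & decided (k \o (h \o f)) p].
  exists (k \o h); split=> //; first exact: sbia_hom_comp.
  move=> q; rewrite inE => /predU1P[-> //|qL].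
  by apply: decided_hom kk _; exact: hL.
(* If the two values agree after meeting with [e], they differ after subtracting [e], which sends
   [e] to zero. Otherwise meeting with [e] keeps them apart, and afterwards [e] is a right identity
   for every value. *)
have [m|m] := pselect (h a ∧ e = h b ∧ e).
  exists (fun x => x ∖ e); split; first exact: diff_hom_r.
    by move=> d; apply: hab; exact: (meet_diff_inj hS m d).
  have [_ kC] := diff_hom_r hS e; left => /=.
  by rewrite -kC (diffxx sS lS).
exists (fun x => x ∧ e); split=> //; first exact: meet_hom.
have [_ kC] := meet_hom hS e; right => z /=.
by rewrite -kC -/e (smeetxx sS) -(smeetA sS) (smeetxx sS).
Qed.

Lemma teval_zero (S : sbiaSig) (hS : is_lh_sbia S) (X : Type) (f : X -> S) t :
  (forall x, f x = 𝟘) -> teval f t = 𝟘.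
Proof.
have [sS lS _] := hS.
move=> f0; elim: t => //= s -> t -> //.
- exact: smeetx0.
- exact: sjoinx0.
- exact: diffxx.
- exact: capxx.
Qed.

Section FreeUnique.
Variables (K : sbiaSig -> Prop) (X : Type).

Definition generated (A : sbiaSig) (a : X -> A) : Prop :=
  forall u : A, exists t, teval a t = u.

Definition generic (A : sbiaSig) (a : X -> A) : Prop :=
  forall s t, teval a s = teval a t -> teq K s t.

(** The inverse evaluates at [g] a term representing the given element of [A]; genericity makes the
    result independent of the term. Its composite with [h] is an endomorphism of [F] fixing the
    generators, hence the identity by uniqueness. *)
Lemma free_iso (A F : sbiaSig) (a : X -> A) (g : X -> F) : K A -> K F ->
  (forall B : sbiaSig, K B -> forall f : X -> B,
    exists! h : F -> B, sbia_hom h /\ forall x, h (g x) = f x) ->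
  generated a -> generic a ->
  exists h : F -> A, [/\ sbia_hom h, bijective h & forall x, h (g x) = a x].
Proof.
move=> KA KF uF gA eA; have [h [[hh ha] _]] := uF A KA a.
have [r rK] := choice gA; pose k u := teval g (r u).
have kE t : k (teval a t) = teval g t by apply: eA => //; rewrite rK.
have hag : h \o g = a by apply/funext.
have kh : sbia_hom k.
  split; last by move=> u v; rewrite -{1}(rK u) -{1}(rK v) (kE (Cap _ _)).
  split.
  - by move=> u v; rewrite -{1}(rK u) -{1}(rK v) (kE (Meet _ _)).
  - by move=> u v; rewrite -{1}(rK u) -{1}(rK v) (kE (Join _ _)).
  - by move=> u v; rewrite -{1}(rK u) -{1}(rK v) (kE (Diff _ _)).
  - exact: (kE Zero).
exists h; split=> //; exists k => [x|u]; last first.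
  by rewrite /k -teval_hom // hag rK.
have [i [_ iU]] := uF F KF g.
have i1 : i = id by apply: iU.
have i2 : i = k \o h.
  apply: iU; split; first exact: sbia_hom_comp.
  by move=> y; rewrite /= ha (kE (Var y)).
by rewrite -[k (h x)]/((k \o h) x) -i2 i1.
Qed.

End FreeUnique.

(** * The product over partitions *)

Lemma mL_nle m (x y : mL m) : nle x y <-> x = ord0 \/ x = y.
Proof.
rewrite /nle /=; split=> [|[->|->]]; last by case: eqP => [->|].
  have [->|nx] := eqVneq x ord0; first by left.
  by case: (y =P ord0) => [_ [/esym]|_ [_ ->]]; [left|right].
by rewrite eqxx; case: eqP.
Qed.

Lemma mL_lh_sbia m : is_lh_sbia (mL m).
Proof.
split; [split | split |].
(* The seventeen laws of a skew Boolean algebra and the two of left-handedness, by comparing the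
   arguments with zero. *)
1-19: by move=> * /=; do ?[case: eqP => //=]; congruence.
move=> x y; split.
- by apply/mL_nle => /=; case: eqP; [right|left].
- by apply/mL_nle => /=; case: eqP => [->|]; [right|left].
- move=> t /mL_nle tx /mL_nle ty; apply/mL_nle => /=.
  by case: tx ty => [->|->] [e|e]; [left|left|left|right; rewrite e eqxx].
Qed.

Lemma prod_nle (I : Type) (A : I -> sbiaSig) (x y : prod_sbia A) :
  nle x y <-> forall i, nle (x i) (y i).
Proof.
split=> [[xy yx] i|xy]; last first.
  by split; apply/functional_extensionality_dep => i; case: (xy i).
by split; [have /(congr1 (@^~ i)) := xy | have /(congr1 (@^~ i)) := yx].
Qed.

Lemma prod_lh_sbia (I : Type) (A : I -> sbiaSig) :
  (forall i, is_lh_sbia (A i)) -> is_lh_sbia (prod_sbia A).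
Proof.
move=> hA; have sA i : is_sba (A i) by case: (hA i).
have lA i : left_handed (A i) by case: (hA i).
split; [split | split |].
1-19: move=> *; apply/functional_extensionality_dep => i /=.
1-17: by case: (sA i).
1-2: by case: (lA i).
move=> x y; split=> [||t /prod_nle tx /prod_nle ty]; apply/prod_nle => i;
  by have [_ _ /(_ (x i) (y i)) [cx cy cg]] := hA i; auto.
Qed.

Lemma prod_proj_hom (I : Type) (A : I -> sbiaSig) (i : I) :
  sbia_hom (fun u : prod_sbia A => u i).
Proof. by []. Qed.

(** The cardinal of this predicate is [stirling2 m k] by definition, so [enum_val] turns ordinals
    below that number into partitions. *)
Definition kpart (m k : nat) : pred {set {set 'I_m}} :=
  [pred P : {set {set 'I_m}} | finset.partition P [set: 'I_m]%SET & #|P| == k].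
Arguments kpart : clear implicits.

(* The indices are the partitions of ['I_n.+1] into at least two blocks. *)
Definition partition_index (n : nat) : finType :=
  {k : 'I_n & 'I_(stirling2 n.+1 k.+2)}.

Section Blocks.
Variable n : nat.
Implicit Types i j : partition_index n.

Definition blocks (i : partition_index n) : {set {set 'I_n.+1}} :=
  @enum_val _ (kpart n.+1 (tag i).+2) (tagged i).

Lemma blocksP i : finset.partition (blocks i) [set: 'I_n.+1]%SET.
Proof. by have /andP[] := enum_valP (tagged i). Qed.

Lemma card_blocks i : #|blocks i| = (tag i).+2.
Proof. by have /andP[_ /eqP] := enum_valP (tagged i). Qed.

Lemma blocks_inj : injective blocks.
Proof.
move=> [k j] [k' j'] e.
have ek : k = k'.
  have := congr1 (fun P : {set {set 'I_n.+1}} => #|P|) e.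
  by rewrite !card_blocks => -[] /val_inj.
by case: _ / ek j' e => j' /enum_val_inj /= ->.
Qed.

Lemma blocks_surj (P : {set {set 'I_n.+1}}) :
  finset.partition P [set: 'I_n.+1]%SET -> 1 < #|P| -> exists i, blocks i = P.
Proof.
move=> hP P1; have lt : #|P|.-2 < n.
  (* A transversal has one point in each block, which bounds the number of blocks. *)
  have : #|P| <= n.+1.
    rewrite -[leqRHS]card_ord -(pblock_transversal (transversalP hP)).
    exact: leq_trans (leq_imset_card _ _) (max_card _).
  by case: #|P| P1 => [|[]].
have PA : P \in kpart n.+1 (Ordinal lt).+2.
  by rewrite inE hP /=; case: #|P| P1 => [|[]].
exists (existT _ (Ordinal lt) (enum_rank_in PA P)).
exact: enum_rankK_in.
Qed.

Lemma labelling_exists i : exists l : 'I_n.+1 -> 'I_(tag i).+2,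
  [/\ l ord0 = ord0,
      forall x y, (l x == l y) =
        (finset.pblock (blocks i) x == finset.pblock (blocks i) y)
    & forall v, exists x, l x = v].
Proof.
set P := blocks i; have hP : finset.partition P _ := blocksP i.
have mP x : finset.pblock P x \in P.
  by rewrite pblock_mem // (cover_partition hP) inE.
pose r B : 'I_(tag i).+2 := cast_ord (card_blocks i) (enum_rank_in (mP ord0) B).
have r_inj : {in P &, injective r}.
  by move=> B C BP CP /cast_ord_inj /(enum_rank_in_inj BP CP).
(* This transposition moves the label 0 to the block of [ord0]. *)
pose t := tperm (r (finset.pblock P ord0)) ord0.
exists (fun x => t (r (finset.pblock P x))); split.
- exact: tpermL.
- by move=> x y; rewrite (inj_eq perm_inj) (inj_in_eq r_inj).
move=> v; pose w := cast_ord (esym (card_blocks i)) (t v).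
have wP := enum_valP w; have /finset.set0Pn[x xw] := partition_neq0 hP wP.
exists x; rewrite (def_pblock (partition_trivIset hP) wP xw).
by rewrite /r enum_valK_in cast_ordKV tpermK.
Qed.

Definition label i : 'I_n.+1 -> 'I_(tag i).+2 := sval (cid (labelling_exists i)).

Lemma label0 i : label i ord0 = ord0.
Proof. by rewrite /label; case: cid => ? []. Qed.

Lemma label_eq i x y :
  (label i x == label i y) =
  (finset.pblock (blocks i) x == finset.pblock (blocks i) y).
Proof. by rewrite /label; case: cid => ? []. Qed.

Lemma label_surj i v : exists x, label i x = v.
Proof. by rewrite /label; case: cid => ? []. Qed.

Lemma label_index_eq i i' :
  (forall x y, (label i x == label i y) = (label i' x == label i' y)) -> i = i'.
Proof.
move=> e; apply: blocks_inj.
rewrite -(equivalence_partition_pblock (blocksP i)).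
rewrite -(equivalence_partition_pblock (blocksP i')).
have same j x y : (y \in finset.pblock (blocks j) x) = (label j x == label j y).
  have tP := partition_trivIset (blocksP j).
  by rewrite label_eq eq_pblock // (cover_partition (blocksP j)) inE.
apply: eq_imset => x; apply/finset.setP => y.
by rewrite !inE !same e.
Qed.

Definition model : sbiaSig := prod_sbia (fun i : partition_index n => mL (tag i).+2).

(** The point [ord0] of ['I_n.+1] is the extra point and stands for zero, so the generators sharing
    its block take the value 0 in that factor. *)
Definition model_gen (x : 'I_n) : model := fun i => label i (lift ord0 x).

Lemma model_lh_sbia : is_lh_sbia model.
Proof. by apply: prod_lh_sbia => i; exact: mL_lh_sbia. Qed.

Lemma teval_model t i :
  teval model_gen t i = teval (A := mL (tag i).+2) (model_gen^~ i) t.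
Proof. exact/esym/(teval_hom _ _ (prod_proj_hom _ i)). Qed.

(** In [mL m.+1] this says that [f p.1 ⊓ f p.2] is non-zero. *)
Definition linked m (f : 'I_n -> 'I_m.+1) (p : 'I_n * 'I_n) : bool :=
  (f p.1 == f p.2) && (f p.1 != ord0).

(** The diagonal pairs tell which generators share the block of the extra point; the other pairs
    tell how the remaining generators are grouped. *)
Lemma linked_index_eq i i' :
  (forall p, linked (model_gen^~ i) p = linked (model_gen^~ i') p) -> i = i'.
Proof.
move=> e; have e0 x : (model_gen x i == ord0) = (model_gen x i' == ord0).
  by have := e (x, x); rewrite /linked /= !eqxx /= => /negb_inj.
apply: label_index_eq => x y; case: (unliftP ord0 x) => [a|] ->;
  case: (unliftP ord0 y) => [b|] ->; rewrite ?label0 ?eqxx //; last first.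
- by rewrite eq_sym [RHS]eq_sym; exact: e0.
- exact: e0.
have := e (a, b); rewrite /linked /= e0; have := e0 b; have := e0 a.
rewrite /model_gen => ea eb; have [a0|na] := eqVneq (label i' (lift ord0 a)) ord0.
  move=> _; move: ea; rewrite a0 eqxx => /eqP ->.
  by rewrite eq_sym eb eq_sym.
by rewrite !andbT.
Qed.

(** In each factor a meet with a non-zero element changes nothing and a meet with zero gives zero,
    while a difference does the opposite. So [s] survives exactly in the factors where [p] is linked
    or unlinked as it is at [i]. *)
Definition restrict (i : partition_index n) (s : term 'I_n)
    (p : 'I_n * 'I_n) : term 'I_n :=
  let c := Cap (Var p.1) (Var p.2) in
  if linked (model_gen^~ i) p then Meet s c else Diff s c.

Lemma teval_restrict i (L : seq ('I_n * 'I_n)) m (f : 'I_n -> mL m.+1) s :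
  teval f (foldl (restrict i) s L) =
  if all (fun p => linked f p == linked (model_gen^~ i) p) L
  then teval f s else ord0.
Proof.
elim: L s => [//|p L IH] s; rewrite /= IH.
have -> : teval f (restrict i s p) =
    if linked f p == linked (model_gen^~ i) p then teval f s else ord0.
  have c0 : (teval f (Cap (Var p.1) (Var p.2)) == ord0) = ~~ linked f p.
    by rewrite /= /linked; case: (f p.1 == f p.2); rewrite ?negbK ?eqxx.
  by rewrite /restrict; case: ifP => _; rewrite [LHS]/= c0; case: linked.
by case: (linked f p == _); rewrite //= if_same.
Qed.

(** A non-zero [v] is the value at [i] of some generator [a]. Cutting [Var a] down by all pairs
    kills every coordinate other than [i], since an index is determined by its linked pairs. *)
Lemma model_atom_term (i : partition_index n) (v : mL (tag i).+2) :
  exists t, teval model_gen t i = v /\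
    forall i', i' != i -> teval model_gen t i' = ord0.
Proof.
have [->|nv] := eqVneq v ord0; first by exists Zero.
have [x xv] := label_surj v.
case: (unliftP ord0 x) xv => [a|] -> xv; last by rewrite -xv label0 eqxx in nv.
exists (foldl (restrict i) (Var a) (enum {: 'I_n * 'I_n})); split.
  by rewrite teval_model teval_restrict /= -xv; case: allP => // -[] p _.
move=> i' ne; rewrite teval_model teval_restrict; case: allP => // h.
case/eqP: ne; apply: linked_index_eq => p.
by apply/eqP/h; rewrite mem_enum.
Qed.

Lemma model_generated : generated model_gen.
Proof.
move=> u; suff [t tP] : exists t, forall i,
    teval model_gen t i = if i \in enum (partition_index n) then u i else ord0.
  exists t; apply/functional_extensionality_dep => i.
  by rewrite tP mem_enum.
(* The terms isolating single coordinates are joined along the enumeration; coordinates not yet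
   listed stay at zero. *)
elim: (enum _) => [|i L [t IH]]; first by exists Zero.
have [s [si s0]] := model_atom_term (u i).
exists (Join s t) => j; have [sM _ _] := mL_lh_sbia (tag j).+2.
have -> : teval model_gen (Join s t) j =
  teval model_gen s j ∨ teval model_gen t j by [].
rewrite IH inE; have [->|ne] := eqVneq j i; last by rewrite s0 // (sjoin0x sM).
by rewrite si; case: ifP => _ /=; [case: ifP|].
Qed.

End Blocks.

(* The blocks are the fibres of [f], the zero fibre being labelled by [0]. *)
Lemma decided_factor n (B : sbiaSig) (hB : is_lh_sbia B) (f : 'I_n -> B) :
    (forall p, decided f p) -> (exists x, f x <> 𝟘) ->
  exists (i : partition_index n) (psi : mL (tag i).+2 -> B),
    [/\ sbia_hom psi, injective psi & f = psi \o (@model_gen n)^~ i].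
Proof.
move=> df [x0 fx0]; have [sB lB gB] := hB.
have top x y : f x <> 𝟘 -> f y ∧ f x = f y.
  by move=> fx; case: (df (x, x)) => /=; rewrite capxx.
(* The extra point receives the value zero. *)
pose f' (t : 'I_n.+1) := oapp f 𝟘 (unlift ord0 t).
have f'0 : f' ord0 = 𝟘 by rewrite /f' unlift_none.
have f'l x : f' (lift ord0 x) = f x by rewrite /f' liftK.
pose r x y := `[< f' x = f' y >].
have er : {in [set: 'I_n.+1]%SET & &, equivalence_rel r}.
  move=> x y z _ _ _; split; first exact/asboolP.
  by move=> /asboolP e; rewrite /r e.
pose P := equivalence_partition r [set: 'I_n.+1]%SET.
have hP : finset.partition P [set: 'I_n.+1]%SET := equivalence_partitionP er.
have Pr x y : (finset.pblock P x == finset.pblock P y) = r x y.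
  rewrite eq_pblock ?(partition_trivIset hP) ?(cover_partition hP) ?inE //.
  exact: (pblock_equivalence_partition er).
(* [x0] lies outside the block of the extra point, so there are two blocks, as an index requires. *)
have P1 : 1 < #|P|.
  apply/card_gt1P; exists (finset.pblock P ord0), (finset.pblock P (lift ord0 x0)).
  split; rewrite ?pblock_mem ?(cover_partition hP) ?inE // Pr.
  by apply/asboolP; rewrite f'0 f'l => /esym.
have [i iP] := blocks_surj hP P1; exists i.
have [s sK] := choice (@label_surj n i).
(* [s] picks a point in each block; the choice does not matter because the blocks are the fibres of
   [f']. *)
pose psi v := f' (s v).
have psiE x : psi (label i x) = f' x.
  by apply/asboolP; rewrite -[asbool _]Pr -iP -label_eq sK.
have psi_inj : injective psi.
  move=> v w /asboolP; rewrite -[asbool _]Pr -iP -label_eq !sK.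
  by move/eqP.
have psi0 : psi ord0 = 𝟘 by rewrite -(label0 i) psiE f'0.
have psiN v : v != ord0 -> psi v <> 𝟘.
  by move=> /eqP nv; rewrite -psi0 => /psi_inj.
have f'top x y : f' x <> 𝟘 -> f' y ∧ f' x = f' y.
  case: (unliftP ord0 x) => [a|] ->; rewrite ?f'0 // f'l => fa.
  by case: (unliftP ord0 y) => [b|] ->; rewrite ?f'0 ?(smeet0x sB) // f'l top.
have psiT v w : w != ord0 -> psi v ∧ psi w = psi v.
  by move=> /psiN; apply: f'top.
exists psi; split=> //; last first.
  by apply/funext => x; rewrite /= /model_gen psiE f'l.
split; first split=> //.
- move=> v w /=; case: eqP => [->|/eqP nw]; last by rewrite psiT.
  by rewrite psi0 (smeetx0 sB).
- move=> v w /=; case: eqP => [->|/eqP nw]; first by rewrite psi0 (sjoinx0 sB).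
  have [->|nv] := eqVneq v ord0; first by rewrite psi0 (sjoin0x sB).
  (* Absorption writes [psi w] as [(psi v ∨ psi w) ∧ psi w], and meeting with [psi w] on the right
     changes neither joinand. *)
  by rewrite -[LHS](sjoin_meetKr sB _ (psi v)) (smeet_joinl sB) !psiT.
- move=> v w /=; case: eqP => [->|/eqP nw].
    by rewrite psi0 (diff_id sB lB) ?(smeetx0 sB).
  have [<- _] := diff_nle sB lB (psi v) (psi w).
  rewrite -{2}(psiT v w) // (smeetA sB) (lh_meetC sB lB) (sdiff_meet sB).
  by rewrite (smeet0x sB).
move=> v w /=; case: eqP => [->|nvw]; first by rewrite capxx.
rewrite psi0; apply/esym.
have capE x y : f' x ⊓ f' y = 𝟘 \/ f' x = f' y.
  have [cx cy _] := gB (f' x) (f' y).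
  case: (unliftP ord0 x) (unliftP ord0 y) cx cy => [a|] -> [b|] ->.
  (* An intersection that lies above every value of [f] equals both of its arguments. *)
  - rewrite !f'l => -[ca ac] [cb bc]; case: (df (a, b)) => /= [|tc]; first by left.
    by right; rewrite -(tc a) ac -bc tc.
  - by rewrite f'0 => _ [<- _]; rewrite (smeetx0 sB); left.
  - by rewrite f'0 => -[<- _] _; rewrite (smeetx0 sB); left.
  - by right.
by case: (capE (s v) (s w)) => // /psi_inj.
Qed.

Lemma separating_component n (B : sbiaSig) (hB : is_lh_sbia B) (f : 'I_n -> B)
    (s t : term 'I_n) : teval f s <> teval f t ->
  exists (i : partition_index n) (psi : mL (tag i).+2 -> B),
    [/\ sbia_hom psi, injective psi
      & teval (@model_gen n) s i <> teval (@model_gen n) t i].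
Proof.
move=> st; have [h [hh hst hL]] := separating_endo hB f (enum {: 'I_n * 'I_n}) st.
rewrite -!teval_hom // in hst.
have [i [psi [psih psi_inj e]]] :
  exists (i : partition_index n) (psi : mL (tag i).+2 -> B),
    [/\ sbia_hom psi, injective psi & h \o f = psi \o (@model_gen n)^~ i].
  apply: decided_factor => // [p|]; first by apply: hL; rewrite mem_enum.
  (* If [h] sent all generators to zero, both terms would evaluate to zero. *)
  apply/existsNP => f0; apply: hst.
  by rewrite !(teval_zero hB) // => x; apply: contrapT => /f0.
exists i, psi; split=> // est; apply: hst.
by rewrite e !(teval_hom _ _ psih) -!teval_model est.
Qed.

Lemma model_generic n : generic is_lh_sbia (@model_gen n).
Proof.
move=> s t e B hB f; apply: contrapT => /(separating_component hB) [i [psi [_ _]]].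
by rewrite e.
Qed.

(** * Counting indices *)

Lemma sum_partition n (G : nat -> nat) :
  \sum_(P : {set {set 'I_n.+1}} | finset.partition P [set: 'I_n.+1]%SET) G #|P| =
  (G 1 + \sum_(i : partition_index n) G (tag i).+2)%N.
Proof.
(* The one-block partition is the only one that is not an index. *)
rewrite (bigD1 [set [set: 'I_n.+1]]%SET (setT_partition n)) cards1; congr addn.
rewrite (eq_bigl (mem [set blocks i | i in partition_index n]%SET)); last first.
  move=> P; apply/andP/imsetP => [[hP]|[i _ ->]].
    rewrite -partition1 // -ltnNge => /(blocks_surj hP)[i <-].
    by exists i.
  by rewrite -partition1 ?blocksP // card_blocks.
rewrite big_imset /=; last by move=> i j _ _; exact: blocks_inj.
by apply: eq_bigr => i _; rewrite card_blocks.
Qed.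

Lemma card_partition_index n : #|partition_index n| = (bell n.+1 - 1)%N.
Proof. by rewrite bellE (sum_partition _ (fun=> 1)) addKn sum1_card. Qed.

(** By [bell_rec] the difference is the sum of [#|P|.+1 - 2] over all partitions, where the
    one-block partition contributes zero. *)
Lemma sum_partition_index n :
  \sum_(i : partition_index n) (tag i).+1 = (bell n.+2 - 2 * bell n.+1)%N.
Proof.
rewrite bell_rec bellE (sum_partition _ S) (sum_partition _ (fun=> 1)).
rewrite mulnDr subnDl big_distrr -sumnB /=.
  by apply: eq_bigr => i _; rewrite muln1 !subSS subn0.
by [].
Qed.

(** These are the two-block partitions, whose factors [mL 2] are the commutative ones. *)
Definition central_index n : {set partition_index n} :=
  [set i : partition_index n | tag i == 0 :> nat]%SET.

Lemma card_central_index n : #|central_index n| = stirling2 n.+1 2.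
Proof.
rewrite -(card_imset _ (@blocks_inj n)); apply: eq_card => P.
rewrite [RHS]inE; apply/imsetP/andP => [[i]|[hP /eqP P2]].
  by rewrite inE => /eqP i0 ->; rewrite blocksP card_blocks i0.
have [|i iP] := blocks_surj hP; first by rewrite P2.
by exists i => //; rewrite inE; have := card_blocks i; rewrite iP P2 => -[<-].
Qed.

Lemma card_eq_fin (T : Type) (A : set T) (U : finType) (D : {pred U}) (f : U -> T) :
  {in D &, injective f} -> A = f @` [set` D] -> A #= `I_#|D|.
Proof.
move=> f_inj ->; apply: card_eq_trans (inj_card_eq _) _.
  by move=> u v; rewrite !in_setE; exact: f_inj.
rewrite card_eq_sym; apply: card_eq_trans card_II _.
have -> : [set` D] = (@enum_val _ D) @` setT.
  apply/seteqP; split=> [u uD|_ [j _ <-]]; last exact: enum_valP.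
  by exists (enum_rank_in uD u); rewrite ?enum_rankK_in.
by rewrite card_eq_sym; apply: inj_card_eq => i j _ _; exact: enum_val_inj.
Qed.

Lemma card_index_fun n :
  #|{dffun forall i : partition_index n, 'I_(tag i).+2}| =
  \prod_(2 <= k < n.+2) k ^ stirling2 n.+1 k.
Proof.
rewrite card_dep_ffun foldrE big_map big_enum /= !big_add1 big_mkord /=.
transitivity (\prod_(k < n) \prod_(j < stirling2 n.+1 k.+2) k.+2).
  by rewrite (sig_big_dep _ (fun=> predT)); apply: eq_bigr => i _; rewrite card_ord.
by apply: eq_bigr => k _; rewrite prod_nat_const card_ord.
Qed.

Lemma mL_Drel m (x y : mL m) : Drel x y <-> (x == ord0) = (y == ord0).
Proof.
rewrite /Drel /=; case: (eqVneq x ord0) => [->|/eqP nx];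
  case: (eqVneq y ord0) => [->|/eqP ny]; rewrite ?eqxx; split=> // -[]; congruence.
Qed.

Lemma prod_Drel (I : Type) (A : I -> sbiaSig) (x y : prod_sbia A) :
  Drel x y <-> forall i, Drel (x i) (y i).
Proof.
split=> [[xy yx] i|xy]; last first.
  by split; apply/functional_extensionality_dep => i; case: (xy i).
by split; [have /(congr1 (@^~ i)) := xy | have /(congr1 (@^~ i)) := yx].
Qed.

(** The equation is a hypothesis because the factor of a central index has type [mL (tag i).+2],
    which becomes [mL 2] only by rewriting. *)
Lemma mL_comm m (x y : mL m) : m = 2 -> x ∧ y = y ∧ x /\ x ∨ y = y ∨ x.
Proof.
move=> m2; case: _ / (esym m2) x y => x y.
by case: x => [[|[|//]] hx]; case: y => [[|[|//]] hy]; split; apply: val_inj.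
Qed.

Lemma mL2_eq m (x y : mL m) : m = 2 -> (x == ord0) = (y == ord0) -> x = y.
Proof.
move=> m2; case: _ / (esym m2) x y => x y.
by case: x => [[|[|//]] hx]; case: y => [[|[|//]] hy] // _; apply: val_inj.
Qed.

Lemma sba_hom_inv (A B : sbaSig) (h : A -> B) (k : B -> A) :
  sba_hom h -> cancel h k -> cancel k h -> sba_hom k.
Proof.
move=> [hM hJ hD h0] hk kh; have hI := can_inj hk.
by split=> *; apply: hI; rewrite ?(hM, hJ, hD, h0, kh).
Qed.

(** * Atoms, D-classes and center *)

Definition flag m (v : mL m) : mL 2 := if v == ord0 then ord0 else ord_max.

Lemma flag_hom m : sba_hom (@flag m).
Proof.
by split=> // v w; rewrite /flag /=; case: (boolP (w == ord0)) => [|/negPf] w0;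
  case: (boolP (v == ord0)) => [|/negPf] v0; rewrite /= ?w0 ?v0 ?eqxx.
Qed.

(** For larger [m] two distinct non-zero elements intersect in zero, while their flags are equal and
    non-zero. *)
Lemma flag_cap m (v w : mL m) : m = 2 -> flag (v ⊓ w) = flag v ⊓ flag w.
Proof.
move=> m2; case: _ / (esym m2) v w => v w.
by case: v => [[|[|//]] hv]; case: w => [[|[|//]] hw]; apply: val_inj.
Qed.

Lemma flag_eq0 m (v : mL m) : (flag v == ord0) = (v == ord0).
Proof. by rewrite /flag; case: (v == ord0). Qed.

Section CentralPart.
Variable n : nat.

Definition boolean_part (u : model n) : pow_sbia (mL 2) #|central_index n| :=
  fun j => flag (u (enum_val j)).

Lemma boolean_part_hom : sbia_hom boolean_part.
Proof.
split; first split.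
- by move=> u v; apply/funext => j; exact: (hom_meet (@flag_hom _)).
- by move=> u v; apply/funext => j; exact: (hom_join (@flag_hom _)).
- by move=> u v; apply/funext => j; exact: (hom_diff (@flag_hom _)).
- by apply/funext => j; exact: (hom_zero (@flag_hom _)).
move=> u v; apply/funext => j; apply: flag_cap.
by have := enum_valP j; rewrite inE => /eqP ->.
Qed.

Definition indicator (s : {set partition_index n}) : model n :=
  fun i => if i \in s then ord_max else ord0.

Lemma indicator_eq0 s i : (indicator s i == ord0) = (i \notin s).
Proof. by rewrite /indicator; case: ifP. Qed.

Definition central_support (w : pow_sbia (mL 2) #|central_index n|) :
    {set partition_index n} :=
  [set enum_val j | j in [set j | w j != ord0]%SET]%SET.

Lemma central_support_sub w : central_support w \subset central_index n.
Proof. by apply/fintype.subsetP => _ /imsetP[j _ ->]; exact: enum_valP. Qed.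

Lemma boolean_partK w : boolean_part (indicator (central_support w)) = w.
Proof.
apply/funext => j; apply: mL2_eq => //.
rewrite flag_eq0 indicator_eq0 /central_support mem_imset ?inE ?negbK //.
exact: enum_val_inj.
Qed.

End CentralPart.

(** * Transport along an isomorphism with the model *)

Section Transport.
Variables (n : nat) (F : sbiaSig) (sF : is_sba F).
Variables (h : F -> model n) (k : model n -> F).
Hypotheses (hh : sbia_hom h) (hk : cancel h k) (kh : cancel k h).
Implicit Types (x y : F) (u : model n) (i j : partition_index n).

Let hI : injective h := can_inj hk.

Lemma transport_ext x y : (forall i, h x i = h y i) -> x = y.
Proof. by move=> e; apply/hI/functional_extensionality_dep. Qed.

Lemma transport_zero i : h 𝟘 i = ord0.
Proof. by have [[_ _ _ ->] _] := hh. Qed.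

Lemma transport_neq0 x : x <> 𝟘 -> exists i, h x i != ord0.
Proof.
move=> x0; apply: contrapT => e; apply: x0; apply: transport_ext => i.
by rewrite transport_zero; apply/eqP/negPn/negP => xi; apply: e; exists i.
Qed.

Lemma transport_nle x y : nle x y <-> forall i, h x i = ord0 \/ h x i = h y i.
Proof.
have [[hM _ _ _] _] := hh; split=> [[xy yx] i|xy].
  have /prod_nle/(_ i)/mL_nle// : nle (h x) (h y).
  by split; rewrite -hM ?xy ?yx.
have [a b] : nle (h x) (h y) by apply/prod_nle => i; apply/mL_nle.
by split; apply: hI; rewrite hM.
Qed.

Lemma transport_Drel x y : Drel x y <-> forall i, (h x i == ord0) = (h y i == ord0).
Proof.
have [[hM _ _ _] _] := hh; split=> [[xy yx] i|xy].
  have /prod_Drel/(_ i)/mL_Drel// : Drel (h x) (h y).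
  by split; rewrite -!hM ?xy ?yx.
have [a b] : Drel (h x) (h y) by apply/prod_Drel => i; apply/mL_Drel.
by split; apply: hI; rewrite !hM.
Qed.

Lemma transport_cls x y : cls (@Drel F) x = cls (@Drel F) y <->
  forall i, (h x i == ord0) = (h y i == ord0).
Proof. by rewrite -transport_Drel; exact: cls_Dquot_eq. Qed.

(** D-classes correspond to supports, the sets of coordinates where [h x] is non-zero, and the
    support of a meet is the intersection of the supports. *)
Lemma transport_cls_nle x y : @nle (Dquot F) (cls _ x) (cls _ y) <->
  forall i, h x i != ord0 -> h y i != ord0.
Proof.
have [[hM _ _ _] _] := hh; have [cM _ _ _] := cls_Dquot_hom sF.
have meet0 a b i : (h (a ∧ b) i == ord0) = (h a i == ord0) || (h b i == ord0).
  by rewrite hM /=; case: (h b i == ord0); rewrite ?eqxx ?orbT ?orbF.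
rewrite /nle -!cM; split=> [[/transport_cls xy _] i|xy].
  by have := xy i; rewrite meet0; case: (h x i == ord0); rewrite //= => ->.
have xy' i : (h x i == ord0) || (h y i == ord0) = (h x i == ord0).
  by case: eqP (xy i) => //= _ /(_ isT) /negPf.
by split; apply/transport_cls => i; rewrite meet0; [|rewrite orbC]; exact: xy'.
Qed.

(** The value is a natural number cast by [inord], so that it has a meaning in the factor of [j]
    without transport along [j = i]. *)
Definition upd u i (v : nat) : model n :=
  fun j => if j == i then inord v else u j.

Lemma upd_same u i v : v < (tag i).+2 -> upd u i v i = v :> nat.
Proof. by rewrite /upd eqxx; exact: inordK. Qed.

Lemma upd_other u i v j : j != i -> upd u i v j = u j.
Proof. by rewrite /upd => /negPf ->. Qed.

Definition point i v : F := k (upd 𝟘 i v).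

Lemma point_same i v : v < (tag i).+2 -> h (point i v) i = v :> nat.
Proof. by rewrite kh; exact: upd_same. Qed.

Lemma point_other i v j : j != i -> h (point i v) j = ord0.
Proof. by move=> ji; rewrite kh upd_other. Qed.

Lemma point_neq0 i v : v < (tag i).+1 -> h (point i v.+1) i != ord0.
Proof. by move=> vi; rewrite -val_eqE /= point_same. Qed.

(** Keeping a single non-zero coordinate of a non-zero element gives an element below it. *)
Lemma atomP x : is_atom x <->
  exists i (v : 'I_(tag i).+1), x = point i v.+1.
Proof.
split=> [[x0 xmin]|[i [v ->]]].
  have [i xi] := transport_neq0 x0; exists i.
  case: (unliftP ord0 (h x i)) (xi) => [v|] e; last by rewrite e eqxx.
  move=> _; exists v; apply/esym/xmin.
    move=> p0; have := point_neq0 (ltn_ord v).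
    by rewrite p0 transport_zero eqxx.
  apply/transport_nle => j; have [->|ji] := eqVneq j i.
    right; apply: ord_inj; rewrite e point_same //.
    exact: (ltn_ord v).
  by rewrite point_other //; left.
split=> [p0|y y0 /transport_nle le].
  by have := point_neq0 (ltn_ord v); rewrite p0 transport_zero eqxx.
have [j yj] := transport_neq0 y0.
have ji : j = i.
  apply: contraTeq yj => ji; rewrite negbK.
  by case: (le j); rewrite ?point_other // => ->.
apply: transport_ext => l; have [->|li] := eqVneq l i; last first.
  by case: (le l) => ->; rewrite ?point_other.
rewrite ji in yj; case: (le i) => // e.
by rewrite e eqxx in yj.
Qed.

(** The factor of [i] has [(tag i).+1] non-zero elements, each giving one atom. *)
Lemma card_atoms :
  [set x : F | is_atom x] #= `I_(bell n.+2 - 2 * bell n.+1).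
Proof.
pose U : finType := {i : partition_index n & 'I_(tag i).+1}.
have <- : #|U| = (bell n.+2 - 2 * bell n.+1)%N.
  rewrite -sum_partition_index card_tagged sumnE big_map big_enum /=.
  by apply: eq_bigr => i _; rewrite card_ord.
apply: (card_eq_fin (f := fun w : U => point (tag w) (tagged w).+1)).
  move=> [i v] [j w] _ _ /= e.
  have ij : i = j.
    apply/eqP/negPn/negP => ij.
    have := point_neq0 (ltn_ord v).
    by rewrite e point_other // eqxx.
  case: _ / ij w e => w /(congr1 (fun x => nat_of_ord (h x i))).
  rewrite !point_same; [|exact: (ltn_ord w)|exact: (ltn_ord v)].
  by move=> [/ord_inj ->].
apply/seteqP; split=> [x /= /atomP[i [v ->]]|_ [[i v] _ <-]].
  by exists (existT _ i v).
by apply/atomP; exists i, v.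
Qed.

(** The atoms are the one-point supports; 1 serves as a non-zero value available in every factor. *)
Lemma class_atomP (C : Dquot F) :
  is_atom C <-> exists i, C = cls (@Drel F) (point i 1).
Proof.
have p1 i : h (point i 1) i != ord0 by exact: point_neq0.
split=> [[C0 Cmin]|[i ->]].
  have [i Ci] : exists i, h (Defs.repr C) i != ord0.
    by apply: transport_neq0 => e; apply: C0; rewrite -(Defs.reprK C) e.
  exists i; apply/esym/Cmin.
    by move/transport_cls => /(_ i); rewrite transport_zero eqxx (negPf (p1 i)).
  rewrite -(Defs.reprK C); apply/transport_cls_nle => j.
  by have [->|ji] := eqVneq j i; rewrite ?Ci // point_other // eqxx.
split=> [/transport_cls/(_ i)|D D0].
  by rewrite transport_zero eqxx (negPf (p1 i)).
rewrite -(Defs.reprK D) => /transport_cls_nle le; apply/transport_cls => j.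
have le0 l : l != i -> h (Defs.repr D) l = ord0.
  move=> li; apply/eqP/negPn/negP => /le.
  by rewrite point_other ?eqxx.
have [->|ji] := eqVneq j i; last by rewrite le0 ?point_other.
rewrite (negPf (p1 i)); apply/negbTE.
have [l Dl] : exists l, h (Defs.repr D) l != ord0.
  by apply: transport_neq0 => e; apply: D0; rewrite -(Defs.reprK D) e.
by have [<-//|li] := eqVneq l i; rewrite le0 ?eqxx in Dl.
Qed.

Lemma card_class_atoms :
  [set C : Dquot F | is_atom C] #= `I_(bell n.+1 - 1).
Proof.
rewrite -card_partition_index.
apply: (card_eq_fin (f := fun i => cls (@Drel F) (point i 1))).
  move=> i j _ _ /transport_cls/(_ i) e; apply/eqP/negPn/negP => ij; move: e.
  by rewrite (negPf (point_neq0 _)) // point_other ?eqxx.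
apply/seteqP; split=> [C /= /class_atomP[i ->]|_ [i _ <-]]; first by exists i.
by apply/class_atomP; exists i.
Qed.

Lemma centerP x : center F x <-> forall i, i \notin central_index n -> h x i = ord0.
Proof.
have [[hM hJ _ _] _] := hh; split=> [cx i|x0 y].
  rewrite inE => ti; apply/eqP/negPn/negP => xi.
  (* [v.+1] is a non-zero value other than [h x i], namely 2 or 1, and it fits because [tag i] is
     positive. Distinct non-zero elements of a factor do not commute. *)
  pose v := if h x i == 1 :> nat then 1 else 0.
  have vi : v < (tag i).+1 by rewrite /v; case: ifP; rewrite // ltnS lt0n.
  have [/(congr1 (fun z => nat_of_ord (h z i)))] := cx (point i v.+1).
  rewrite !hM /= (negPf xi) (negPf (point_neq0 vi)) point_same // => e _.
  by move: e; rewrite /v; case: eqP => [->|].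
have key i : h x i ∧ h y i = h y i ∧ h x i /\ h x i ∨ h y i = h y i ∨ h x i.
  have [ti|ti] := boolP (i \in central_index n).
    by apply: mL_comm; move: ti; rewrite inE => /eqP ->.
  have [sM _ _] := mL_lh_sbia (tag i).+2; rewrite x0 //.
  by split; rewrite ?(smeet0x sM) ?(smeetx0 sM) ?(sjoin0x sM) ?(sjoinx0 sM).
by split; apply: transport_ext => i; rewrite ?hM ?hJ; case: (key i).
Qed.

Lemma center_closed : sba_closed (center F).
Proof.
have [[hM hJ hD _] _] := hh.
by split=> [x y /centerP x0 /centerP y0|x y /centerP x0 /centerP y0
  |x y /centerP x0 /centerP y0|]; apply/centerP => i ti;
  rewrite ?(hM, hJ, hD, transport_zero) //= ?x0 ?y0.
Qed.

(** D-related elements have the same support, and in two-element factors the support determines the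
    element. *)
Lemma center_Drel x y : center F x -> Drel x y -> y = x.
Proof.
move=> /centerP x0 /transport_Drel xy; apply: transport_ext => i.
have [ti|ti] := boolP (i \in central_index n).
  by apply: mL2_eq => //; move: ti; rewrite inE => /eqP ->.
by apply/eqP; rewrite x0 // -xy x0.
Qed.

Lemma singleton_DclassP (C : Dquot F) :
  singleton_Dclass C <-> exists2 x, center F x & C = cls (@Drel F) x.
Proof.
have rD x : Drel x x by split; rewrite !(smeetxx sF).
split=> [[x]|[x cx ->]]; last first.
  exists x; apply/seteqP; split=> [y /= /(center_Drel cx) //|_ ->]; exact: rD.
rewrite -(Defs.reprK C); move: (Defs.repr C) => z /= zx.
have xz : z = x by have := rD z; rewrite zx.
exists x; last by rewrite xz.
apply/centerP => i; rewrite inE => ti; apply/eqP/negPn/negP => xi.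
(* Again [v.+1] is another non-zero value; substituting it keeps the support, hence the D-class, but
   changes the element. *)
pose v := if h x i == 1 :> nat then 1 else 0.
have vi : v < (tag i).+1 by rewrite /v; case: ifP; rewrite // ltnS lt0n.
have : Drel z (k (upd (h x) i v.+1)).
  apply/transport_Drel => j; rewrite xz kh; have [->|ji] := eqVneq j i.
    by rewrite (negPf xi) -val_eqE /= upd_same.
  by rewrite upd_other.
rewrite zx => /(congr1 (fun y => nat_of_ord (h y i))).
by rewrite kh upd_same // /v => /esym; case: eqP => [->|].
Qed.

Lemma indicator_center (s : {set partition_index n}) :
  s \subset central_index n -> center F (k (indicator s)).
Proof.
move=> /fintype.subsetP sc; apply/centerP => i ti; apply/eqP.
by rewrite kh indicator_eq0; apply: contra ti => /sc.
Qed.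

Lemma center_indicator x : center F x ->
  k (indicator [set i | h x i != ord0]%SET) = x.
Proof.
move=> cx; apply/(center_Drel cx)/transport_Drel => i.
by rewrite kh indicator_eq0 inE negbK.
Qed.

(** A singleton class is given by the support of its central element, an arbitrary subset of
    [central_index]. *)
Lemma card_singleton_classes :
  [set C : Dquot F | singleton_Dclass C] #= `I_(2 ^ #|central_index n|).
Proof.
rewrite -card_powerset.
apply: (card_eq_fin (f := fun s => cls (@Drel F) (k (indicator s)))).
  move=> s s' _ _ /transport_cls e; apply/finset.setP => i.
  by have := e i; rewrite !kh !indicator_eq0 => /negb_inj.
apply/seteqP; split=> [C /= /singleton_DclassP[x cx ->]|_ [s sc <-]]; last first.
  apply/singleton_DclassP; exists (k (indicator s)) => //; apply: indicator_center.
  by move: sc; rewrite /= powersetE.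
exists [set i | h x i != ord0]%SET; last by rewrite center_indicator.
rewrite /= powersetE; apply/fintype.subsetP => i; rewrite inE; apply: contraR.
by move/centerP: cx => /(_ i) x0 /x0 ->.
Qed.

Lemma center_iso : exists cC : sba_closed (center F),
  sba_iso (sub_sba cC) (pow_sbia (mL 2) #|central_index n|).
Proof.
have [[bM bJ bD b0] _] := @boolean_part_hom n; have [[hM hJ hD h0] _] := hh.
exists center_closed, (fun a => boolean_part (h (sval a))); split.
  by split=> *; rewrite /= ?(hM, hJ, hD, h0) ?(bM, bJ, bD, b0).
exists (fun w => exist _ _ (indicator_center (central_support_sub w))).
  move=> [x cx]; apply: eq_exist => /=; rewrite -[RHS](center_indicator cx).
  congr (k (indicator _)); apply/finset.setP => i; rewrite inE.
  apply/imsetP/idP => [[j]|xi]; first by rewrite inE flag_eq0 => xj ->.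
  have ci : i \in central_index n.
    by apply: contraR xi; move/centerP: cx => /(_ i) x0 /x0 ->.
  exists (enum_rank_in ci i); last by rewrite enum_rankK_in.
  by rewrite inE /boolean_part flag_eq0 enum_rankK_in.
by move=> w /=; rewrite kh boolean_partK.
Qed.

End Transport.

(** * The free generalized Boolean algebra *)

Definition boolean_sbia (A : sbiaSig) : Prop :=
  is_gba A /\ forall x y : A, x ⊓ y = x ∧ y.

(** With commutative operations [∧] is the meet of the natural order. This lets the separation
    result for left-handed algebras be applied to Boolean ones. *)
Lemma boolean_lh_sbia (A : sbiaSig) : boolean_sbia A -> is_lh_sbia A.
Proof.
move=> [[sA c1 c2] cE]; have I := smeetxx sA; have AA := smeetA sA.
have AJ := sjoinA sA.
have J (x : A) : x ∨ x = x by rewrite -{2}(I x) (sjoin_meetK sA).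
split=> //; first split=> x y.
- by rewrite c1 AA I.
- by rewrite c2 AJ J c2.
move=> x y; rewrite cE; split.
- by split; [rewrite c1 AA I | rewrite AA I].
- by split; [rewrite -AA I | rewrite c1 -AA I].
- move=> t [tx xt] [ty yt]; split; first by rewrite AA tx ty.
  by rewrite -AA yt xt.
Qed.

Lemma pow2_boolean N : boolean_sbia (pow_sbia (mL 2) N).
Proof.
have [sP _ _] := prod_lh_sbia (fun _ : 'I_N => mL_lh_sbia 2).
split; first split=> //.
1-2: by move=> x y; apply/funext => j; case: (@mL_comm 2 (x j) (y j)).
move=> x y; apply/funext => j; rewrite /=.
by case: (x j) => [[|[|//]] hx]; case: (y j) => [[|[|//]] hy]; apply: val_inj.
Qed.

Section BooleanGenerators.
Variable n : nat.

Definition boolean_gen (x : 'I_n) := boolean_part (model_gen x).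

Lemma boolean_generated : generated boolean_gen.
Proof.
move=> w; have [t tE] := model_generated (indicator (central_support w)).
exists t; rewrite -(boolean_partK w) -tE.
exact: (teval_hom _ _ (@boolean_part_hom n)).
Qed.

(** Terms that differ in [B] differ in a factor embedded in [B]. As [B] is commutative, that factor
    has just one non-zero element, so its index is central and [boolean_part] retains it. *)
Lemma boolean_generic : generic boolean_sbia boolean_gen.
Proof.
move=> s t e B KB f; apply: contrapT.
move=> /(separating_component (boolean_lh_sbia KB))[i [psi [[[pM _ _ _] _] pI]]].
have ci : i \in central_index n.
  rewrite inE -leqn0 leqNgt; apply/negP => ti.
  have [[_ c1 _] _] := KB.
  have ne v : 0 < v < (tag i).+2 -> (inord v == ord0 :> 'I_(tag i).+2) = false.
    by move=> /andP[v0 vi]; rewrite -val_eqE /= inordK // eqn0Ngt v0.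
  (* In a larger factor the elements 1 and 2 do not commute, and [psi] is injective. *)
  have := c1 (psi (inord 1)) (psi (inord 2)).
  rewrite -!pM /= !ne // => /pI /(congr1 val) /=.
  by rewrite !inordK.
apply; apply: mL2_eq; first by move: ci; rewrite inE => /eqP ->.
have := congr1 (@^~ (enum_rank_in ci i)) e.
rewrite !(teval_hom _ _ (@boolean_part_hom n)) /boolean_part enum_rankK_in //.
by move=> /(congr1 (fun v => v == ord0)); rewrite !flag_eq0.
Qed.

End BooleanGenerators.

(** * From the model to an arbitrary free algebra *)

Lemma free_reindex (K : sbiaSig -> Prop) (X Y : Type) (F : sbiaSig)
    (g : X -> F) (e : Y -> X) : bijective e ->
    (forall B : sbiaSig, K B -> forall f : X -> B,
      exists! h : F -> B, sbia_hom h /\ forall x, h (g x) = f x) ->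
  forall B : sbiaSig, K B -> forall f : Y -> B,
    exists! h : F -> B, sbia_hom h /\ forall y, h (g (e y)) = f y.
Proof.
move=> [d ed de] uF B KB f; have [h [[hh hg] hU]] := uF B KB (f \o d).
exists h; split=> [|h' [hh' hg']]; first by split=> // y; rewrite hg /= ed.
by apply: hU; split=> // x; rewrite -{1}(de x) hg'.
Qed.

Definition curry_model n (u : model n) :
    prod_sbia (fun k : 'I_n => pow_sbia (mL k.+2) (stirling2 n.+1 k.+2)) :=
  fun k j => u (existT _ k j).

Lemma curry_model_bij n : bijective (@curry_model n).
Proof.
exists (fun (w : forall k : 'I_n, 'I_(stirling2 n.+1 k.+2) -> mL k.+2)
  (i : partition_index n) => w (tag i) (tagged i)) => // u.
by apply/functional_extensionality_dep => -[].
Qed.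

Lemma card_model n :
  [set: model n] #= `I_(\prod_(2 <= k < n.+2) k ^ stirling2 n.+1 k).
Proof.
rewrite -card_index_fun.
apply: (card_eq_fin
  (f := fun u : {dffun forall i : partition_index n, 'I_(tag i).+2} =>
          (fun i => u i) : model n)).
  move=> u v _ _ e; apply/ffunP => i.
  exact: (congr1 (fun w : model n => w i) e).
apply/seteqP; split=> // u _.
exists (finfun (u : forall i : partition_index n, 'I_(tag i).+2)) => //.
by apply/functional_extensionality_dep => i; rewrite ffunE.
Qed.

Theorem theorem28 (n : nat) (hn : (1 <= n)%N) (X : finType) (hX : #|X| = n)
    (F : sbiaSig) (g : X -> F) (hF : is_free_lh_sbia g) :
  [/\ (* (1) *)
      [set C : Dquot F | is_atom C] #= `I_(bell n.+1 - 1),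
      (* (2) *)
      sbia_iso F
        (prod_sbia (fun k : 'I_n => pow_sbia (mL k.+2) (stirling2 n.+1 k.+2)))
      /\ [set: F] #= `I_(\prod_(2 <= k < n.+2) k ^ stirling2 n.+1 k),
      (* (3) *)
      [set x : F | is_atom x] #= `I_(bell n.+2 - 2 * bell n.+1)
    & (* (4) *)
      [/\ [set C : Dquot F | singleton_Dclass C] #= `I_(2 ^ stirling2 n.+1 2),
          2 ^ stirling2 n.+1 2 = 2 ^ (2 ^ n - 1),
          (exists cC : sba_closed (center F),
             sba_iso (sub_sba cC) (pow_sbia (mL 2) (2 ^ n - 1)))
        & forall (G : sbaSig) (j : X -> G), is_free_gba j ->
             sba_iso (pow_sbia (mL 2) (2 ^ n - 1)) G]].
Proof.
move: hn => _; subst n; set n := #|X|.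
have eX : bijective (@enum_val X predT).
  exists enum_rank; [exact: enum_valK | exact: enum_rankK].
have [lF uF] := hF; have [sF _ _] := lF.
have [h [hh [k hk kh] _]] := free_iso (@model_lh_sbia n) lF
  (free_reindex eX uF) (@model_generated n) (@model_generic n).
have NE : #|central_index n| = (2 ^ n - 1)%N.
  by rewrite card_central_index stirling2_2.
split.
- exact: (card_class_atoms sF hh hk kh).
- split.
    exists (@curry_model n \o h); split; first exact: (sbia_hom_comp hh).
    by apply: bij_comp; [exact: curry_model_bij | exists k].
  apply: card_eq_trans (card_model n).
  have -> : [set: F] = k @` [set: model n].
    by apply/seteqP; split=> // x _; exists (h x).
  by apply: inj_card_eq => u v _ _; exact: (can_inj kh).
- exact: (card_atoms hh hk kh).
split.
- by rewrite -card_central_index; exact: (card_singleton_classes sF hh hk kh).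
- by rewrite stirling2_2.
- by rewrite -NE; exact: (center_iso hh hk kh).
(* Reading [G] in the larger signature, with [∧] as intersection, makes [free_iso] applicable to
   it. *)
move=> G j [gG uG]; rewrite -NE; pose G' := @SbiaSig G (@smeet G).
have KG : boolean_sbia G' by [].
have uG' (B : sbiaSig) : boolean_sbia B -> forall f : X -> B,
    exists! p : G' -> B, sbia_hom p /\ forall x, p (j x) = f x.
  move=> [gB cB] f; have [p [[hp pj] pU]] := uG B gB f.
  exists p; split=> [|q [[hq _] qj]]; last exact: pU.
  by split=> //; split=> // x y; rewrite cB; exact: hom_meet.
have [p [[hp _] [q pq qp] _]] := free_iso (pow2_boolean _) KG
  (free_reindex eX uG') (@boolean_generated n) (@boolean_generic n).
by exists q; split; [exact: (sba_hom_inv hp pq qp) | exists p].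
Qed.
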